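(* Let $\lambda\ge -\tfrac12$ be real. Consider the monic Gegenbauer polynomials $C_n^{(\lambda)}(x)$, with $T_n=C_n^{(0)}$ and $U_n=C_n^{(1)}$ the monic Chebyshev polynomials of the first and second kinds. The following are generating functions of the form $A(t)F(xtA(t)-R(t))$ for the indicated polynomial sets, with the indicated closed forms. (1) For $C_n^{(\lambda)}$, $\lambda\neq 0$: $A(t)=1$, $R(t)=\frac{t^2}{4}$, $F(t)=(1-t)^{-\lambda}$, giving $$\sum_{n\ge 0}\frac{(\lambda)_n}{n!}C_n^{(\lambda)}(x)t^n=\Big(1-tx+\frac{t^2}{4}\Big)^{-\lambda}.$$ (2) For $C_n^{(\lambda)}$, $\lambda\neq 0$: $A(t)=\big(1-\frac{t^2}{4}\big)^{-1/\lambda}$, $R(t)=\big(1+\frac{t^2}{4}\big)A(t)-1$, $F(t)=(1-t)^{-\lambda-1}$, giving $$\sum_{n\ge0}\frac{(\lambda+1)_n}{n!}C_n^{(\lambda)}(x)t^n=\Big(1-\frac{t^2}{4}\Big)\Big(1-tx+\frac{t^2}{4}\Big)^{-\lambda-1}.$$ (3) For $T_n$: $A(t)=1$, $R(t)=\frac{t^2}{4}$, $F(t)=1-\ln(1-t)$, giving $$\sum_{n\ge1}\frac1n T_n(x)t^n=-\ln\Big(1-xt+\frac{t^2}{4}\Big).$$ (4) For $U_n$: $A(t)$ arbitrary (with $A(0)=1$), $R(t)=\big(1+\frac{t^2}{4}\big)A(t)-1$, $F(t)=\frac1{1-t}$, giving $$\sum_{n\ge0}U_n(x)t^n=\frac{1}{1-xt+\frac{t^2}{4}}.$$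 (5) For $U_n$, with parameters $\rho\ne0$, $\alpha_1\neq 0$: $A(t)=1$, $R(t)=\frac{\rho t^2}{2}$, $F(t)=\frac{1+(\alpha_1-2\rho)t}{1-2\rho t}$, giving $$1+\alpha_1\sum_{n\ge1}2^{n-1}\rho^{n-1}U_n(x)t^n=\frac{1+(\alpha_1-2\rho)\big(xt-\frac{\rho}{2}t^2\big)}{1-2\rho xt+\rho^2t^2}.$$ (6) For $U_n$, with complex parameters $\rho,\alpha_1$ such that all the numbers $\alpha_n=2^n\big[U_n(\rho)+(\frac{\alpha_1}{2}-\rho)U_{n-1}(\rho)\big]$ ($n\ge1$), $\alpha_0=1$, are nonzero: $A(t)=\frac{4}{4-t^2}$, $R(t)=\frac{2\rho t^2}{4-t^2}$, $F(t)=\frac{1+(\alpha_1-2\rho)t}{1-2\rho t+t^2}$, giving $$\sum_{n\ge0}\alpha_nU_n(x)t^n=\frac{4-t^2+2(\alpha_1-2\rho)(2xt-\rho t^2)}{4-8\rho xt+(4\rho^2+4x^2-2)t^2-2\rho xt^3+\frac{t^4}{4}}.$$ Conversely, these are the only ones: for every $\lambda\ge-\frac12$, every generating function of the form $A(t)F(xtA(t)-R(t))$ of $\{C_n^{(\lambda)}\}$ (including $\{T_n\}$ for $\lambda=0$ and $\{U_n\}$ for $\lambda=1$) is, up to normalization, one of those listed above for that polynomial set.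
   Context: All power series are formal power series with complex coefficients. $(\mu)_0=1$, $(\mu)_n=\mu(\mu+1)\cdots(\mu+n-1)$. A monic polynomial set (MPS) is a sequence $\{P_n(x)\}_{n\ge0}$ with $P_n(x)=x^n+$ lower degree terms. Generating function of the form $A(t)F(xtA(t)-R(t))$ for an MPS $\{P_n\}$: data $\big((\alpha_n)_{n\ge0},A,R,F\big)$ where $\alpha_n\in\mathbb C$, $\alpha_n\ne0$ for all $n$, $\alpha_0=1$, $F(t)=\sum_{n\ge0}\alpha_nt^n$, and $A,R$ are formal power series with $A(0)=1$, $R(0)=0$, such that $$A(t)F(xtA(t)-R(t))=\sum_{n\ge0}\alpha_nP_n(x)t^n$$ as formal power series in $t$ with coefficients in $\mathbb C[x]$. ''Up to normalization'' means up to the following operations, which preserve this property: (a) rescaling of $t$ by $c\in\mathbb C\setminus\{0\}$: $(\alpha_n,A(t),R(t),F(t))\mapsto(c^n\alpha_n,A(ct),c^{-1}R(ct),F(ct))$; (b) only when $A(t)=1$: replacing $F$ by $1+\kappa(F-1)$ with $\kappa\in\mathbb C\setminus\{0\}$ (so $\alpha_n\mapsto\kappa\alpha_n$ for $n\ge1$). The monic Gegenbauer (ultraspherical) polynomials are $$C_n^{(\lambda)}(x)=\frac{(2\lambda)_n}{2^n(\lambda)_n}\,{}_2F_1\Big(-n,\,n+2\lambda;\,\lambda+\tfrac12;\,\tfrac{1-x}{2}\Big),$$ understood as limits in $\lambda$ when $\lambda\in\{0,-\frac12\}$. Equivalently $C_{-1}^{(\lambda)}=0$, $C_0^{(\lambda)}=1$,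 $C_{n+1}^{(\lambda)}(x)=xC_n^{(\lambda)}(x)-\omega_nC_{n-1}^{(\lambda)}(x)$ with $\omega_1=\frac{1}{2(1+\lambda)}$ and $\omega_n=\frac{n(n-1+2\lambda)}{4(n+\lambda)(n-1+\lambda)}$ for $n\ge2$. In particular $T_n$ and $U_n$ are monic (so $U_n$ is $2^{-n}$ times the usual Chebyshev polynomial of the second kind). *)

(* Defs.v *)
From HB Require Import structures.
From mathcomp Require Import all_boot all_order all_algebra.
From mathcomp Require Import boolp classical_sets reals complex.
From mathcomp Require Import topology normedtype ring lra.

Set Implicit Arguments.
Unset Strict Implicit.
Unset Printing Implicit Defensive.
Import Order.TTheory GRing.Theory Num.Theory.
Local Open Scope ring_scope.
Local Open Scope complex_scope.

Record fps (K : Type) := Fps { fps_coef :> nat -> K }.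

Section FpsRing.
Variable K : comNzRingType.
Implicit Types f g h : fps K.

HB.instance Definition _ := gen_eqMixin (fps K).
HB.instance Definition _ := gen_choiceMixin (fps K).

Lemma fpsP f g : f =1 g <-> f = g.
Proof. by split=> [|->//]; case: f g => [f] [g] /funext /= ->. Qed.

Definition fps_zero : fps K := Fps (fun=> 0).
Definition fps_opp f : fps K := Fps (fun n => - f n).
Definition fps_add f g : fps K := Fps (fun n => f n + g n).
Definition fps_one : fps K := Fps (fun n => (n == 0)%:R).
Definition fps_mul f g : fps K :=
  Fps (fun n => \sum_(i < n.+1) f i * g (n - i)%N).

Fact fps_addA : associative fps_add.
Proof. by move=> f g h; apply/fpsP => n /=; rewrite addrA. Qed.
Fact fps_addC : commutative fps_add.
Proof. by move=> f g; apply/fpsP => n /=; rewrite addrC. Qed.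
Fact fps_add0 : left_id fps_zero fps_add.
Proof. by move=> f; apply/fpsP => n /=; rewrite add0r. Qed.
Fact fps_addN : left_inverse fps_zero fps_opp fps_add.
Proof. by move=> f; apply/fpsP => n /=; rewrite addNr. Qed.

HB.instance Definition _ :=
  GRing.isZmodule.Build (fps K) fps_addA fps_addC fps_add0 fps_addN.

Fact fps_mulC : commutative fps_mul.
Proof.
move=> f g; apply/fpsP => n /=; rewrite (reindex_inj rev_ord_inj) /=.
by apply: eq_bigr => i _; rewrite mulrC subSS subKn // -ltnS.
Qed.

Fact fps_mulE f g n : fps_mul f g n = \sum_(i < n.+1) f i * g (n - i)%N.
Proof. by []. Qed.

Fact fps_mulE_rev f g n : fps_mul f g n = \sum_(i < n.+1) f (n - i)%N * g i.
Proof. by rewrite fps_mulC fps_mulE; apply: eq_bigr => i _; rewrite mulrC. Qed.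

Fact fps_mulA : associative fps_mul.
Proof.
move=> f g h; apply/fpsP => i; rewrite fps_mulE fps_mulE_rev.
pose coef3 j k := f j * (g (i - j - k)%N * h k).
transitivity (\sum_(j < i.+1) \sum_(k < i.+1 | (k <= i - j)%N) coef3 j k).
  apply: eq_bigr => j _; rewrite fps_mulE_rev big_distrr /=.
  by rewrite (big_ord_narrow_leq (leq_subr _ _)).
rewrite (exchange_big_dep predT) //; apply: eq_bigr => k _.
transitivity (\sum_(j < i.+1 | (j <= i - k)%N) coef3 j k).
  apply: eq_bigl => j; rewrite -ltnS -(ltnS j) -!subSn ?leq_ord //.
  by rewrite -subn_gt0 -(subn_gt0 j) -!subnDA addnC.
rewrite (big_ord_narrow_leq (leq_subr _ _)) [fps_mul f g _]fps_mulE big_distrl /=.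
by apply: eq_bigr => j _; rewrite /coef3 -!subnDA addnC mulrA.
Qed.

Fact fps_mul1 : left_id fps_one fps_mul.
Proof.
move=> f; apply/fpsP => n /=; rewrite big_ord_recl subn0 mul1r big1 ?addr0 //.
by move=> i _; rewrite mul0r.
Qed.

Fact fps_mulDl : left_distributive fps_mul +%R.
Proof.
move=> f g h; apply/fpsP => n /=; rewrite -big_split.
by apply: eq_bigr => i _; rewrite mulrDl.
Qed.

Fact fps_one_neq0 : fps_one != 0.
Proof.
by apply/eqP => /fpsP/(_ 0%N) /= /eqP; rewrite oner_eq0.
Qed.

HB.instance Definition _ := GRing.Zmodule_isComNzRing.Build (fps K)
  fps_mulA fps_mulC fps_mul1 fps_mulDl fps_one_neq0.

Lemma fps_coef0 n : (0 : fps K) n = 0. Proof. by []. Qed.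
Lemma fps_coef1 n : (1 : fps K) n = (n == 0%N)%:R. Proof. by []. Qed.
Lemma fps_coefN f n : (- f) n = - f n. Proof. by []. Qed.
Lemma fps_coefD f g n : (f + g) n = f n + g n. Proof. by []. Qed.
Lemma fps_coefB f g n : (f - g) n = f n - g n. Proof. by []. Qed.
Lemma fps_coefM f g n : (f * g) n = \sum_(i < n.+1) f i * g (n - i)%N.
Proof. by []. Qed.

Definition fps_const (c : K) : fps K := Fps (fun n => if n is 0%N then c else 0).
Definition fps_var : fps K := Fps (fun n => (n == 1%N)%:R).

(* [fps_comp F G] is F(G(t)), meaningful when G(0) = 0: then G^k is O(t^k), and
   the terms with k > n do not contribute to the coefficient of t^n. *)
Definition fps_comp (F G : fps K) : fps K :=
  Fps (fun n => \sum_(k < n.+1) F k * (G ^+ k) n).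

(* F(ct) *)
Definition fps_dilate (c : K) (F : fps K) : fps K := Fps (fun n => c ^+ n * F n).

End FpsRing.

Arguments fps_var {K}.
Notation "''t'" := (@fps_var _) (at level 0) : ring_scope.
Notation "c %:S" := (fps_const c) (at level 1, format "c %:S") : ring_scope.

Section FpsUnitRing.
Variable K : comUnitRingType.
Implicit Types f g h : fps K.

Definition fps_unit : {pred fps K} := fun f => f 0%N \is a GRing.unit.

(* [:: g_0; ...; g_(n-1)], where g_n = - f_0^-1 (f_1 g_(n-1) + ... + f_n g_0) *)
Fixpoint fps_inv_seq f n : seq K :=
  if n is m.+1 then
    let s := fps_inv_seq f m in
    rcons s (if m is 0%N then (f 0%N)^-1
             else - (f 0%N)^-1 * \sum_(i < m) f i.+1 * s`_(m - i.+1))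
  else [::].

Definition fps_inv f : fps K :=
  if fps_unit f then Fps (fun n => (fps_inv_seq f n.+1)`_n) else f.

Lemma size_fps_inv_seq f n : size (fps_inv_seq f n) = n.
Proof. by elim: n => //= n IH; rewrite size_rcons IH. Qed.

Lemma nth_fps_inv_seq f n i :
  (i < n)%N -> (fps_inv_seq f n)`_i = (fps_inv_seq f i.+1)`_i.
Proof.
elim: n => // n IH; rewrite ltnS leq_eqVlt => /orP[/eqP-> //|ltin].
rewrite [fps_inv_seq f n.+1]/= nth_rcons size_fps_inv_seq ltin; exact: IH.
Qed.

Fact fps_mulVx : {in fps_unit, left_inverse 1 fps_inv *%R}.
Proof.
move=> f uf; rewrite /fps_inv; have -> : fps_unit f by [].
rewrite mulrC; apply/fpsP => n; rewrite fps_coefM fps_coef1.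
rewrite big_ord_recl subn0; case: n => [|n].
  by rewrite big_ord0 addr0 /= divrr.
rewrite [X in f _ * X]/fps_coef [fps_inv_seq _ _]/= -/(fps_inv_seq f n.+1).
rewrite nth_rcons size_fps_inv_seq ltnn eqxx mulrA mulrN divrr // mulN1r.
rewrite -[X in _ + X]opprK -opprD; apply/eqP; rewrite oppr_eq0 subr_eq0.
apply/eqP; apply: eq_bigr => i _; rewrite /= /bump /= add1n.
by rewrite -[rcons _ _]/(fps_inv_seq f n.+1) nth_fps_inv_seq // subSS ltnS leq_subr.
Qed.

Fact fps_unitPl f g : g * f = 1 -> fps_unit f.
Proof.
move=> /fpsP/(_ 0%N); rewrite fps_coefM big_ord_recl big_ord0 addr0 => gf1.
by apply/unitrPr; exists (g 0%N); rewrite mulrC.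
Qed.

Fact fps_inv_out : {in [predC fps_unit], fps_inv =1 id}.
Proof. by move=> f /negbTE nuf; rewrite /fps_inv [fps_unit f]nuf. Qed.

HB.instance Definition _ := GRing.ComNzRing_hasMulInverse.Build (fps K)
  fps_mulVx fps_unitPl fps_inv_out.

Lemma fps_unitE f : (f \is a GRing.unit) = (f 0%N \is a GRing.unit).
Proof. by []. Qed.

Definition pochhammer (a : K) n : K := \prod_(i < n) (a + i%:R).

(* G^a for G(0) = 1, through (1 - u)^a = \sum_n (-a)_n / n! u^n; meant for rings
   containing the rationals. *)
Definition fps_power (G : fps K) (a : K) : fps K :=
  fps_comp (Fps (fun n => pochhammer (- a) n / n`!%:R)) (1 - G).

(* ln G for G(0) = 1, through ln(1 - u) = - \sum_(n >= 1) u^n / n; meant for rings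
   containing the rationals. *)
Definition fps_ln (G : fps K) : fps K :=
  fps_comp (Fps (fun n => if n is 0%N then 0 else - n%:R^-1)) (1 - G).

End FpsUnitRing.

Section Gegenbauer.
Variable K : fieldType.

Definition gegenbauer_omega (lambda : K) n : K :=
  if n == 1%N then (2 * (1 + lambda))^-1
  else n%:R * (n%:R - 1 + 2 * lambda)
       / (4 * (n%:R + lambda) * (n%:R - 1 + lambda)).

Fixpoint gegenbauer_pair (lambda : K) n : {poly K} * {poly K} :=
  if n is m.+1 then
    let: (p, q) := gegenbauer_pair lambda m in
    ('X * p - gegenbauer_omega lambda m *: q, p)
  else (1, 0).

(* Monic Gegenbauer polynomials, by their three-term recurrence; see
   [gegenbauer_2F1E] and [gegenbauer_2F1_cvg] for the hypergeometric form and its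
   limits at the exceptional parameters. *)
Definition gegenbauer lambda n : {poly K} := (gegenbauer_pair lambda n).1.

Lemma gegenbauer0 lambda : gegenbauer lambda 0 = 1. Proof. by []. Qed.

Lemma gegenbauer1 lambda : gegenbauer lambda 1 = 'X.
Proof. by rewrite /gegenbauer /= scaler0 subr0 mulr1. Qed.

Lemma gegenbauerS lambda n : gegenbauer lambda n.+2 =
  'X * gegenbauer lambda n.+1
  - gegenbauer_omega lambda n.+1 *: gegenbauer lambda n.
Proof.
by rewrite /gegenbauer /=; case: (gegenbauer_pair lambda n) => p q.
Qed.

End Gegenbauer.

Lemma map_gegenbauer (K L : fieldType) (f : {rmorphism K -> L}) lambda n :
  map_poly f (gegenbauer lambda n) = gegenbauer (f lambda) n.
Proof.
have omegaE m : f (gegenbauer_omega lambda m) = gegenbauer_omega (f lambda) m.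
  rewrite /gegenbauer_omega; case: eqP => _.
    by rewrite fmorphV rmorphM rmorph_nat rmorphD rmorph1.
  by rewrite fmorph_div !rmorphM !rmorph_nat !rmorphD !rmorphM rmorphN rmorph1 !rmorph_nat.
suff H m : map_poly f (gegenbauer lambda m) = gegenbauer (f lambda) m
     /\ map_poly f (gegenbauer lambda m.+1) = gegenbauer (f lambda) m.+1.
  by case: (H n).
elim: m => [|m [IH1 IH2]].
  by rewrite !gegenbauer0 !gegenbauer1 rmorph1 map_polyX.
split=> //; rewrite !gegenbauerS rmorphB rmorphM /= map_polyX map_polyZ.
by rewrite IH1 IH2 omegaE.
Qed.

Section Hypergeometric.
Variable K : numFieldType.

Lemma pochhammer0 (a : K) : pochhammer a 0 = 1.
Proof. by rewrite /pochhammer big_ord0. Qed.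
Lemma pochhammerSr (a : K) n : pochhammer a n.+1 = pochhammer a n * (a + n%:R).
Proof. by rewrite /pochhammer big_ord_recr. Qed.
Lemma pochhammerSl (a : K) n : pochhammer a n.+1 = a * pochhammer (a + 1) n.
Proof.
rewrite /pochhammer big_ord_recl addr0; congr (_ * _); apply: eq_bigr => i _.
by rewrite -addrA -nat1r.
Qed.

Definition gegenbauer_2F1 (lambda : K) n : {poly K} :=
  (pochhammer (2 * lambda) n / (2 ^+ n * pochhammer lambda n)) *:
  \sum_(k < n.+1)
    (pochhammer (- n%:R) k * pochhammer (n%:R + 2 * lambda) k
     / (pochhammer (lambda + 2^-1) k * k`!%:R)) *: (2^-1 *: (1 - 'X)) ^+ k.

Variable lambda : K.
Hypothesis lambda_generic : forall m : nat, 2 * lambda + m%:R != 0.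

Let h n k := (pochhammer (2 * lambda) n / (2 ^+ n * pochhammer lambda n)) *
    (pochhammer (- n%:R) k * pochhammer (n%:R + 2 * lambda) k
     / (pochhammer (lambda + 2^-1) k * k`!%:R)).

Let Y : {poly K} := 2^-1 *: (1 - 'X).

Let lam_neq0 m : lambda + m%:R != 0.
Proof.
apply: contra (lambda_generic m.*2) => /eqP h0.
by rewrite -(mul2n m) natrM -mulrDr h0 mulr0.
Qed.

Let lamh_neq0 m : lambda + 2^-1 + m%:R != 0.
Proof.
apply: contra (lambda_generic m.*2.+1) => /eqP h0.
have -> : 2 * lambda + m.*2.+1%:R = 2 * (lambda + 2^-1 + m%:R).
  by rewrite -(natr1 m.*2) -(mul2n m) natrM; field.
by rewrite h0 mulr0.
Qed.

Let poch_neq0 (a : K) : (forall m : nat, a + m%:R != 0) ->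
  forall n, pochhammer a n != 0.
Proof. by move=> ha n; apply/prodf_neq0 => i _. Qed.

Let fact_neq0 k : k`!%:R != 0 :> K.
Proof. by rewrite pnatr_eq0 -lt0n fact_gt0. Qed.

Let poch_oppn n k : (n < k)%N -> pochhammer (- n%:R : K) k = 0.
Proof.
move=> nk; apply/eqP/prodf_eq0; exists (Ordinal nk) => //=.
by rewrite addrC subrr.
Qed.

Let h_sum n N : (n < N)%N ->
  gegenbauer_2F1 lambda n = \sum_(k < N) h n k *: Y ^+ k.
Proof.
move=> nN; rewrite /gegenbauer_2F1 scaler_sumr.
transitivity (\sum_(k < n.+1) h n k *: Y ^+ k).
  by apply: eq_bigr => k _; rewrite scalerA.
rewrite (big_ord_widen N (fun k : nat => h n k *: Y ^+ k)) // big_mkcond.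
apply: eq_bigr => k _; case: ltnP => // nk.
by rewrite /h poch_oppn // !mul0r mulr0 scale0r.
Qed.

Let lam_neq0l n : n%:R + lambda != 0.
Proof. by rewrite addrC. Qed.

Let lam_neq0l1 n : n%:R + 1 + lambda != 0.
Proof. by rewrite natr1. Qed.

Let omega_generic n : gegenbauer_omega lambda n.+1 =
  (n%:R + 1) * (n%:R + 2 * lambda)
  / (4 * (n%:R + 1 + lambda) * (n%:R + lambda)).
Proof.
rewrite /gegenbauer_omega natr1; case: n => [|n] /=; last first.
  by rewrite -(natr1 n.+1) addrK.
have l0 : lambda != 0 by have := lam_neq0 0; rewrite addr0.
have l1 : 1 + lambda != 0 by have := lam_neq0 1; rewrite addrC.
by rewrite !add0r; field; rewrite ?l0 ?l1.
Qed.

Let pref n := pochhammer (2 * lambda) n / (2 ^+ n * pochhammer lambda n).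

Let prefS n : pref n.+1 =
  pref n * (2 * lambda + n%:R) / (2 * (n%:R + lambda)).
Proof.
rewrite /pref !pochhammerSr exprS.
have q0 := poch_neq0 lam_neq0 n; have l0 := lam_neq0 n; have l0' := lam_neq0l n.
have r0 : (2 : K) ^+ n != 0 by rewrite expf_neq0 // pnatr_eq0.
move: (pochhammer _ n) (pochhammer _ n) (2 ^+ n) q0 r0 => p q r q0 r0.
by field; rewrite r0 q0 l0'.
Qed.

Let h_rec0 n : h n.+2 0 = h n.+1 0 - gegenbauer_omega lambda n.+1 * h n 0.
Proof.
have l0 := lam_neq0l n; have l1 := lam_neq0l1 n.
rewrite omega_generic /h -!/(pref _) !prefS !pochhammer0 fact0 -!natr1.
by field; rewrite l0 l1.
Qed.

Let h_rec1 n : h n.+2 1 =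
  h n.+1 1 - 2 * h n.+1 0 - gegenbauer_omega lambda n.+1 * h n 1.
Proof.
have l0 := lam_neq0l n; have l1 := lam_neq0l1 n.
have lh := lamh_neq0 0; rewrite addr0 in lh.
have lh2 : 2 * lambda + 1 != 0 by have := lambda_generic 1.
rewrite omega_generic /h -!/(pref _) !prefS.
rewrite !(pochhammerSr _ 0) !pochhammer0 fact0 (factS 0) fact0 -!natr1.
by field; rewrite ?[lambda * 2]mulrC ?l0 ?l1 ?lh ?lh2.
Qed.


Let h_recSS n j : h n.+2 j.+2 =
  h n.+1 j.+2 - 2 * h n.+1 j.+1 - gegenbauer_omega lambda n.+1 * h n j.+2.
Proof.
have l0 := lam_neq0l n; have l1 := lam_neq0l1 n.
have lh := lamh_neq0 j.+1.
have f0 : (j.+2%:R : K) != 0 by rewrite pnatr_eq0.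
rewrite omega_generic /h -!/(pref _) !prefS.
rewrite (factS j.+1) natrM (pochhammerSr (lambda + 2^-1) j.+1).
have a1 : pochhammer (- n.+2%:R : K) j.+2 =
    (n%:R + 2) * (n%:R + 1) * pochhammer (- n%:R) j.
  rewrite 2!pochhammerSl (_ : - n.+2%:R + 1 + 1 = - n%:R); last first.
    by rewrite -!natr1; ring.
  by rewrite -!natr1; ring.
have a2 : pochhammer (- n.+1%:R : K) j.+1 =
    - (n%:R + 1) * pochhammer (- n%:R) j.
  rewrite pochhammerSl (_ : - n.+1%:R + 1 = - n%:R); last first.
    by rewrite -!natr1; ring.
  by rewrite -!natr1.
have b1 : pochhammer (n.+2%:R + 2 * lambda) j.+2 =
    pochhammer (n%:R + 2 + 2 * lambda) j * (n%:R + 2 + 2 * lambda + j%:R)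
    * (n%:R + 2 + 2 * lambda + j%:R + 1).
  rewrite !pochhammerSr (_ : n.+2%:R = n%:R + 2); last first.
    by rewrite -!natr1; ring.
  by rewrite -(natr1 j); ring.
have b2 : pochhammer (n.+1%:R + 2 * lambda) j.+1 =
    (n%:R + 1 + 2 * lambda) * pochhammer (n%:R + 2 + 2 * lambda) j.
  rewrite pochhammerSl -(natr1 n).
  by rewrite (_ : n%:R + 1 + 2 * lambda + 1 = n%:R + 2 + 2 * lambda) //; ring.
have b3 : pochhammer (n%:R + 2 * lambda) j.+2 =
    (n%:R + 2 * lambda) * (n%:R + 1 + 2 * lambda)
    * pochhammer (n%:R + 2 + 2 * lambda) j.
  rewrite 2!pochhammerSl.
  rewrite (_ : n%:R + 2 * lambda + 1 + 1 = n%:R + 2 + 2 * lambda); last by ring.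
  by ring.
rewrite a1 b1 (pochhammerSr (- n.+1%:R)) (pochhammerSr (n.+1%:R + 2 * lambda)).
rewrite a2 b2 b3 2!(pochhammerSr (- n%:R)).
have D0 := poch_neq0 lamh_neq0 j.+1; have F0 := fact_neq0 j.+1.
move: (pochhammer (_ + _^-1) _) (j.+1`!%:R) D0 F0 => D F D0 F0.
move: (pochhammer _ j) (pochhammer _ j) (pref n) => B E p.
have lh2 : 2 * lambda + 1 + 2 * (j%:R + 1) != 0.
  have := lambda_generic (j.*2.+3); rewrite -(mul2n j) -addn3 natrD natrM.
  by rewrite (_ : 2 * lambda + (2 * j%:R + 3) = 2 * lambda + 1 + 2 * (j%:R + 1)) //; ring.
have f0' : 2 + j%:R != 0 :> K by rewrite -natrD pnatr_eq0.
have f0'' : j%:R + 1 + 1 != 0 :> K by rewrite !natr1 pnatr_eq0.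
rewrite -(natr1 j) in lh *; rewrite -(natr1 j.+1) -(natr1 j).
by field; rewrite ?[lambda * 2]mulrC ?[_ * 2]mulrC ?l0 ?l1 ?lh2 ?D0 ?F0 ?f0''.
Qed.

Lemma gegenbauer_2F1E n : gegenbauer lambda n = gegenbauer_2F1 lambda n.
Proof.
have XY : 'X = 1 - 2 *: Y.
  by rewrite /Y scalerA divff ?pnatr_eq0 // scale1r opprB addrC subrK.
have rec m : gegenbauer_2F1 lambda m.+2 = 'X * gegenbauer_2F1 lambda m.+1
    - gegenbauer_omega lambda m.+1 *: gegenbauer_2F1 lambda m.
  rewrite (@h_sum m.+2 m.+3) // (@h_sum m m.+3) ?ltnS ?leqW //.
  rewrite {1}XY mulrBl mul1r {1}(@h_sum m.+1 m.+3) ?ltnS ?leqW //.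
  rewrite (@h_sum m.+1 m.+2) //.
  rewrite -scalerAl mulr_sumr !scaler_sumr.
  rewrite 3!(big_ord_recl m.+2) -!/(nat_of_ord _) /=.
  rewrite h_rec0 !expr0.
  set S1 := \sum_(i < m.+2) h m.+2 _ *: _.
  set S2 := \sum_(i < m.+2) h m.+1 _ *: _.
  set S3 := \sum_(i < m.+2) 2 *: _.
  set S4 := \sum_(i < m.+2) gegenbauer_omega _ _ *: _.
  suff -> : S1 = S2 - S3 - S4.
    rewrite scalerA scalerBl; ring.
  rewrite /S1 /S2 /S3 /S4 -!sumrB; apply: eq_bigr => i _.
  rewrite /bump /= add1n -scalerAr -exprS !scalerA -!scalerBl.
  by congr (_ *: _); case: (nat_of_ord i) => [|j]; [rewrite h_rec1 | rewrite h_recSS].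
have base0 : gegenbauer_2F1 lambda 0 = 1.
  rewrite (@h_sum 0 1) // big_ord_recl big_ord0 addr0 /h !pochhammer0 fact0.
  by rewrite expr0 !(mulr1, invr1) scale1r.
have base1 : gegenbauer_2F1 lambda 1 = 'X.
  rewrite (@h_sum 1 2) // !big_ord_recl big_ord0 addr0 /h -!/(pref _) /=.
  rewrite !(pochhammerSr _ 0) !pochhammer0 fact0 (factS 0) fact0 expr0 expr1.
  rewrite prefS {1 2}/pref !pochhammer0 expr0 XY.
  have l0 := lam_neq0 0; have lh := lamh_neq0 0; rewrite !addr0 in l0 lh.
  have lh2 : 2 * lambda + 1 != 0 by have := lambda_generic 1.
  rewrite -[X in X - _]scale1r -scaleNr.
  by congr (_ *: _ + _ *: _); field; rewrite ?[lambda * 2]mulrC ?lh2 l0.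
suff H m : gegenbauer lambda m = gegenbauer_2F1 lambda m
     /\ gegenbauer lambda m.+1 = gegenbauer_2F1 lambda m.+1 by case: (H n).
elim: m => [|m [IH1 IH2]]; first by rewrite gegenbauer0 gegenbauer1 base0 base1.
by split=> //; rewrite gegenbauerS rec IH1 IH2.
Qed.

End Hypergeometric.

Section Limits.
Import numFieldNormedType.Exports.
Local Open Scope classical_set_scope.
Variable R : realType.

Lemma gegenbauer_omega_cvg (lambda : R) n : -1 < lambda ->
  gegenbauer_omega mu n.+1 @[mu --> lambda] --> gegenbauer_omega lambda n.+1.
Proof.
move=> hl; rewrite /gegenbauer_omega; case: n => [|n] /=.
  apply: cvgV; first by apply: lt0r_neq0; lra.
  by apply: cvgM; [exact: cvg_cst | apply: cvgD; [exact: cvg_cst|exact: cvg_id]].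
have n0 : 0 <= n%:R :> R by [].
have d0 : 4 * (n.+2%:R + lambda) * (n.+2%:R - 1 + lambda) != 0.
  rewrite -(natr1 n.+1) -(natr1 n).
  by rewrite !mulf_neq0 //; apply: lt0r_neq0; lra.
apply: cvgM.
  apply: cvgM; first exact: cvg_cst.
  apply: cvgD; first exact: cvg_cst.
  by apply: cvgM; [exact: cvg_cst|exact: cvg_id].
apply: cvgV => //; apply: cvgM; last first.
  by apply: cvgD; [exact: cvg_cst|exact: cvg_id].
apply: cvgM; first exact: cvg_cst.
by apply: cvgD; [exact: cvg_cst|exact: cvg_id].
Qed.

Lemma gegenbauer_cvg (lambda : R) n i : -1 < lambda ->
  (gegenbauer mu n)`_i @[mu --> lambda] --> (gegenbauer lambda n)`_i.
Proof.
move=> hl; suff H m : (forall j,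
    (gegenbauer mu m)`_j @[mu --> lambda] --> (gegenbauer lambda m)`_j)
  /\ (forall j,
    (gegenbauer mu m.+1)`_j @[mu --> lambda] --> (gegenbauer lambda m.+1)`_j).
  by case: (H n).
elim: m => [|m [IH1 IH2]]; split=> // j.
- by under eq_fun do rewrite gegenbauer0; exact: cvg_cst.
- by rewrite gegenbauer1; under eq_fun do rewrite gegenbauer1; exact: cvg_cst.
- rewrite gegenbauerS coefB coefXM coefZ.
  under eq_fun do rewrite gegenbauerS coefB coefXM coefZ.
  apply: cvgB; last by apply: cvgM; [exact: gegenbauer_omega_cvg | exact: IH1].
  by case: eqP => _; [exact: cvg_cst | exact: IH2].
Qed.

Lemma gegenbauer_2F1_cvg (lambda : R) n i : -1 < lambda ->
  (gegenbauer_2F1 mu n)`_i @[mu --> lambda^'] --> (gegenbauer lambda n)`_i.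
Proof.
move=> hl.
apply: (@cvg_trans _ ((gegenbauer mu n)`_i @[mu --> lambda^'])); last first.
  exact: cvg_within_filter (gegenbauer_cvg hl).
have nz (c : R) : \forall mu \near lambda^', mu != c.
  have [lc|lc|<-] := ltgtP lambda c; last exact: nbhs_dnbhs_neq.
    by apply: nbhs_dnbhs; near=> mu; rewrite lt_eqF //; near: mu; exact: lt_nbhsl.
  by apply: nbhs_dnbhs; near=> mu; rewrite gt_eqF //; near: mu; exact: lt_nbhsr.
apply: near_eq_cvg; near=> mu.
have m1 : -1 < mu by near: mu; apply: nbhs_dnbhs; exact: lt_nbhsr.
have mu0 : mu != 0 by near: mu.
have mu2 : mu != - 2^-1 by near: mu.
rewrite gegenbauer_2F1E // => -[|[|m]]; apply/eqP => h.
- by move/eqP: mu0; apply; lra.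
- by move/eqP: mu2; apply; lra.
- by have : 0 <= m%:R :> R := ler0n _ _; rewrite -!natr1 in h; lra.
Unshelve. all: by end_near.
Qed.
End Limits.

Section GeneratingFunctions.
Variable R : realType.
Local Notation C := R[i].

Definition monic_poly_set (P : nat -> {poly C}) : Prop :=
  forall n, P n \is monic /\ size (P n) = n.+1.

Record genfun := GenFun {
  gf_alpha : nat -> C;
  gf_A : fps C;
  gf_R : fps C;
  gf_F : fps C
}.

(* A power series in t over C, seen as a power series in t over C[x]. *)
Definition fps_lift (f : fps C) : fps {poly C} := Fps (fun n => (f n)%:P).

Definition weighted_series (alpha : nat -> C) (P : nat -> {poly C}) :
  fps {poly C} := Fps (fun n => alpha n *: P n).

Definition is_genfun (P : nat -> {poly C}) (d : genfun) : Prop :=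
  [/\ monic_poly_set P,
      gf_alpha d 0 = 1 /\ (forall n, gf_alpha d n != 0),
      gf_F d = Fps (gf_alpha d),
      gf_A d 0%N = 1 /\ gf_R d 0%N = 0
    & fps_lift (gf_A d)
      * fps_comp (fps_lift (gf_F d))
                 ('X%:S * 't * fps_lift (gf_A d) - fps_lift (gf_R d))
      = weighted_series (gf_alpha d) P].

Definition gf_rescale (c : C) (d : genfun) : genfun :=
  GenFun (fun n => c ^+ n * gf_alpha d n) (fps_dilate c (gf_A d))
         ((c^-1)%:S * fps_dilate c (gf_R d)) (fps_dilate c (gf_F d)).

Definition gf_affine (kappa : C) (d : genfun) : genfun :=
  GenFun (fun n => if n is 0%N then gf_alpha d 0 else kappa * gf_alpha d n)
         (gf_A d) (gf_R d) (1 + kappa%:S * (gf_F d - 1)).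

Inductive normalization : genfun -> genfun -> Prop :=
| norm_refl d : normalization d d
| norm_rescale c d : c != 0 -> normalization d (gf_rescale c d)
| norm_affine kappa d :
    kappa != 0 -> gf_A d = 1 -> normalization d (gf_affine kappa d)
| norm_trans d1 d2 d3 :
    normalization d1 d2 -> normalization d2 d3 -> normalization d1 d3.

Definition chebyshevT : nat -> {poly C} := gegenbauer 0.
Definition chebyshevU : nat -> {poly C} := gegenbauer 1.

Definition gf_C1 (lambda : C) : genfun :=
  GenFun (fun n => pochhammer lambda n / n`!%:R)
         1 ('t ^+ 2 / 4) (fps_power (1 - 't) (- lambda)).

Definition gf_C2 (lambda : C) : genfun :=
  let A := fps_power (1 - 't ^+ 2 / 4) (- lambda^-1) in
  GenFun (fun n => pochhammer (lambda + 1) n / n`!%:R)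
         A ((1 + 't ^+ 2 / 4) * A - 1) (fps_power (1 - 't) (- lambda - 1)).

Definition gf_T : genfun :=
  GenFun (fun n => if n is 0%N then 1 else n%:R^-1)
         1 ('t ^+ 2 / 4) (1 - fps_ln (1 - 't)).

Definition gf_U1 (A : fps C) : genfun :=
  GenFun (fun=> 1) A ((1 + 't ^+ 2 / 4) * A - 1) (1 / (1 - 't)).

Definition gf_U2 (rho alpha1 : C) : genfun :=
  GenFun (fun n => if n is m.+1 then alpha1 * 2 ^+ m * rho ^+ m else 1)
         1 (rho%:S * 't ^+ 2 / 2)
         ((1 + (alpha1 - 2 * rho)%:S * 't) / (1 - (2 * rho)%:S * 't)).

Definition alpha_U3 (rho alpha1 : C) (n : nat) : C :=
  if n is m.+1 then
    2 ^+ n * ((chebyshevU n).[rho]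
              + (alpha1 / 2 - rho) * (chebyshevU m).[rho])
  else 1.

Definition gf_U3 (rho alpha1 : C) : genfun :=
  GenFun (alpha_U3 rho alpha1)
         (4 / (4 - 't ^+ 2)) (2 * rho%:S * 't ^+ 2 / (4 - 't ^+ 2))
         ((1 + (alpha1 - 2 * rho)%:S * 't)
          / (1 - (2 * rho)%:S * 't + 't ^+ 2)).

Inductive listed (lambda : C) : genfun -> Prop :=
| listed_C1 : lambda != 0 -> listed lambda (gf_C1 lambda)
| listed_C2 : lambda != 0 -> listed lambda (gf_C2 lambda)
| listed_T : lambda = 0 -> listed lambda gf_T
| listed_U1 (A : fps C) : lambda = 1 -> A 0%N = 1 -> listed lambda (gf_U1 A)
| listed_U2 rho alpha1 :
    lambda = 1 -> rho != 0 -> alpha1 != 0 -> listed lambda (gf_U2 rho alpha1)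
| listed_U3 rho alpha1 :
    lambda = 1 -> (forall n, alpha_U3 rho alpha1 n != 0) ->
    listed lambda (gf_U3 rho alpha1).

End GeneratingFunctions.

(* Main.v *)
From HB Require Import structures.
Require Import Defs.
From mathcomp Require Import all_boot all_order all_algebra.
From mathcomp Require Import reals complex ring lra.

Set Implicit Arguments.
Unset Strict Implicit.
Unset Printing Implicit Defensive.
Import Order.TTheory GRing.Theory Num.Theory.
Local Open Scope ring_scope.
Local Open Scope complex_scope.

(** Each side of the theorem comes down to recurrences.

    Existence.  Put D = 1 - xt + t^2/4.  The series (lambda)_n / n! C_n t^n
    and D^(-lambda) both solve D y' = - lambda D' y with y(0) = 1: for the
    first this is the three-term recurrence.  A linear equation of order one
    determines its solution, hence [gf_C1]; applying 1 + (t/lambda) d/dt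
    gives [gf_C2].  The composite A F(xtA - R) collapses to the same closed
    forms since, in all the cases where F is a power of 1 - t or its
    logarithm, 1 - (xtA - R) = A D.  For T_n the equation is D y' = - D',
    and for U_n the recurrence itself says that D times the series is 1.  In
    [gf_U2] and [gf_U3] F is rational, and multiplying the series by the
    asserted denominator leaves a check on coefficients; in [gf_U3] the
    weights satisfy a three-term recurrence of their own, and the products
    alpha_n U_n(x) a recurrence of order four.

    Uniqueness.  Let G = A F(xtA - R), L = A'/A and Q = R'/A.  Eliminating F
    from the derivatives of G gives the linear equation
      t G_t = t L G + (x (1 + t L) - Q) G_x    ([genfun_pde]).
    Its coefficients are relations between the weights alpha_n, the
    coefficients of the P_n, and those of L and Q ([genfun_coef_add]).  At
    step i the only new unknowns are L_i and Q_i, and they occur as L_i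
    alpha_j - Q_i alpha_(j+1) for every j.  So the weights determine L and
    Q, hence A and R, unless alpha is a geometric sequence ([genfun_uniq]);
    geometric weights force lambda = 1 and give [gf_U1].  It remains to find
    the weights.

    The polynomials have a parity, so L_0 = Q_0 = L_2 = Q_2 = 0 when the
    weights are not geometric, and steps 1 and 3 read
      (j + 2) alpha_(j+2) = 2 (j + 1 + lambda) (Q_1 alpha_(j+1) - L_1 alpha_j),
      L_1 omega_(j+2) alpha_(j+2) = Q_3 alpha_(j+1) - L_3 alpha_j.
    If L_1 = 0, the first relation gives the weights of [gf_C1] or [gf_T].
    If L_1 is not 0 and lambda = 1, it has constant coefficients and gives
    those of [gf_U3].  In the remaining case the two relations together make
    alpha_j / alpha_(j+1) a Moebius function of j; substituting it back
    yields a polynomial identity in j that leaves only the ratio of the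
    weights of [gf_C2] ([alpha_ratio]).  In each case a listed datum, after
    normalization, has the same weights as the given one, so it is the given
    one. *)

(** * Formal power series: coefficients, composition, differentiation *)

Section FpsCalculus.
Variable K : comNzRingType.
Implicit Types (f g h F G H : fps K) (c : K).

Lemma fps_ext f g : (forall n, f n = g n) -> f = g.
Proof. by move/fpsP. Qed.

Lemma fps_coefMn f m n : (f *+ m) n = f n *+ m.
Proof. by elim: m => [|m IH]; rewrite ?mulr0n ?mulrS ?fps_coefD ?IH. Qed.

Lemma fps_coefC c n : (c%:S) n = if n is 0%N then c else 0.
Proof. by []. Qed.

Lemma fps_coefCM c f n : (c%:S * f) n = c * f n.
Proof.
rewrite fps_coefM big_ord_recl subn0 big1 ?addr0 // => i _.
by rewrite mul0r.
Qed.

Lemma fps_coefXM f n : ('t * f) n = if n is m.+1 then f m else 0.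
Proof.
rewrite fps_coefM big_ord_recl /= mul0r add0r; case: n => [|n].
  by rewrite big_ord0.
rewrite big_ord_recl /= mul1r subSS subn0 big1 ?addr0 // => i _.
by rewrite mul0r.
Qed.

Lemma fps_coefX2M f n : ('t ^+ 2 * f) n = if n is m.+2 then f m else 0.
Proof. by rewrite expr2 -mulrA fps_coefXM; case: n => // n; rewrite fps_coefXM. Qed.

Lemma fps_coefXn k n : ('t ^+ k : fps K) n = (n == k)%:R.
Proof.
by elim: k n => [|k IH] [|n]; rewrite ?expr0 ?exprS ?fps_coefXM // IH.
Qed.

Lemma fps_coefM0 f g : (f * g) 0%N = f 0%N * g 0%N.
Proof. by rewrite fps_coefM big_ord1 subn0. Qed.

Lemma fps_constD c d : (c + d)%:S = c%:S + d%:S :> fps K.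
Proof. by apply: fps_ext => -[|n]; rewrite fps_coefD //= addr0. Qed.

Lemma fps_constM c d : (c * d)%:S = c%:S * d%:S :> fps K.
Proof. by apply: fps_ext => -[|n]; rewrite fps_coefCM //= mulr0. Qed.

Lemma fps_constN c : (- c)%:S = - c%:S :> fps K.
Proof. by apply: fps_ext => -[|n]; rewrite fps_coefN //= oppr0. Qed.

Lemma fps_constB c d : (c - d)%:S = c%:S - d%:S :> fps K.
Proof. by rewrite fps_constD fps_constN. Qed.

Lemma fps_const1 : 1%:S = 1 :> fps K.
Proof. by apply: fps_ext => -[|n]. Qed.

Lemma fps_constX c n : (c ^+ n)%:S = c%:S ^+ n :> fps K.
Proof.
by elim: n => [|n IH]; rewrite ?expr0 ?fps_const1 // !exprS fps_constM IH.
Qed.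

Lemma fps_const_nat n : (n%:R)%:S = n%:R :> fps K.
Proof.
by apply: fps_ext => -[|m]; rewrite fps_coefMn fps_coef1 //= mul0rn.
Qed.

Lemma fps_coefX_lt G k n : G 0%N = 0 -> (n < k)%N -> (G ^+ k) n = 0.
Proof.
move=> G0; elim: k n => // k IH n nk; rewrite exprS fps_coefM big_ord_recl.
rewrite G0 mul0r add0r big1 // => i _; rewrite IH ?mulr0 //=.
by rewrite /bump /= add1n; case: n nk i => [_ []//|n nk i]; rewrite subSS; apply: leq_ltn_trans (leq_subr _ _) _.
Qed.

(** Since G(0) = 0 only finitely many powers of G reach a given coefficient, so
    the sum defining the composition may be cut off anywhere beyond it. *)
Lemma fps_coef_compM F G H n N : G 0%N = 0 -> (n < N)%N ->
  (fps_comp F G * H) n = \sum_(k < N) F k * (G ^+ k * H) n.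
Proof.
move=> G0 nN.
transitivity (\sum_(i < n.+1) \sum_(k < N) F k * ((G ^+ k) i * H (n - i)%N)).
  rewrite fps_coefM; apply: eq_bigr => i _ /=.
  rewrite (big_ord_widen N (fun k : nat => F k * (G ^+ k) i)); last first.
    by apply: leq_ltn_trans nN; rewrite -ltnS.
  rewrite big_mkcond mulr_suml; apply: eq_bigr => k _.
  case: ltnP => [_|ik]; first by rewrite mulrA.
  by rewrite fps_coefX_lt // !(mul0r, mulr0).
rewrite exchange_big; apply: eq_bigr => k _.
by rewrite fps_coefM mulr_sumr.
Qed.

Lemma fps_coef_comp F G n N : G 0%N = 0 -> (n < N)%N ->
  fps_comp F G n = \sum_(k < N) F k * (G ^+ k) n.
Proof.
move=> G0 nN; rewrite -[fps_comp F G]mulr1 (fps_coef_compM _ _ G0 nN).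
by apply: eq_bigr => k _; rewrite mulr1.
Qed.

Lemma fps_coef_compE F G n : fps_comp F G n = \sum_(k < n.+1) F k * (G ^+ k) n.
Proof. by []. Qed.

Lemma fps_comp0 F G : fps_comp F G 0%N = F 0%N.
Proof. by rewrite /= big_ord1 expr0 mulr1. Qed.

Lemma fps_compD F1 F2 G : fps_comp (F1 + F2) G = fps_comp F1 G + fps_comp F2 G.
Proof.
apply: fps_ext => n /=; rewrite -big_split /=; apply: eq_bigr => k _.
by rewrite mulrDl.
Qed.

Lemma fps_compN F G : fps_comp (- F) G = - fps_comp F G.
Proof.
by apply: fps_ext => n /=; rewrite -sumrN; apply: eq_bigr => k _; rewrite mulNr.
Qed.

Lemma fps_compB F1 F2 G : fps_comp (F1 - F2) G = fps_comp F1 G - fps_comp F2 G.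
Proof. by rewrite fps_compD fps_compN. Qed.

Lemma fps_compCM c F G : fps_comp (c%:S * F) G = c%:S * fps_comp F G.
Proof.
apply: fps_ext => n; rewrite fps_coefCM !fps_coef_compE mulr_sumr; apply: eq_bigr => k _.
by rewrite fps_coefCM mulrA.
Qed.

Lemma fps_compC c G : fps_comp c%:S G = c%:S.
Proof.
apply: fps_ext => n; rewrite fps_coef_compE big_ord_recl expr0 fps_coef1 big1 ?addr0.
  by case: n => [|n]; rewrite ?mulr1 ?mulr0.
by move=> i _; rewrite mul0r.
Qed.

Lemma fps_comp_one G : fps_comp 1 G = 1.
Proof. by rewrite -fps_const1 fps_compC. Qed.

Lemma fps_compXM F G : G 0%N = 0 -> fps_comp ('t * F) G = G * fps_comp F G.
Proof.
move=> G0; apply: fps_ext => n; rewrite (@fps_coef_comp _ _ _ n.+2) // big_ord_recl.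
rewrite fps_coefXM mul0r add0r [G * _]mulrC (fps_coef_compM _ _ G0 (ltnSn n)).
by apply: eq_bigr => k _; rewrite fps_coefXM exprSr.
Qed.

Lemma fps_comp_var G : G 0%N = 0 -> fps_comp 't G = G.
Proof. by move=> G0; rewrite -[X in fps_comp X]mulr1 fps_compXM // fps_comp_one mulr1. Qed.

Lemma fps_comp_varr F : fps_comp F 't = F.
Proof.
apply: fps_ext => n; rewrite fps_coef_compE big_ord_recr fps_coefXn eqxx mulr1 big1.
  exact: add0r.
by move=> i _; rewrite fps_coefXn gtn_eqF ?mulr0 //=.
Qed.

Definition fps_deriv f : fps K := Fps (fun n => f n.+1 *+ n.+1).

Lemma fps_derivD f g : fps_deriv (f + g) = fps_deriv f + fps_deriv g.
Proof. by apply: fps_ext => n /=; rewrite mulrnDl. Qed.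

Lemma fps_derivN f : fps_deriv (- f) = - fps_deriv f.
Proof. by apply: fps_ext => n /=; rewrite mulNrn. Qed.

Lemma fps_derivB f g : fps_deriv (f - g) = fps_deriv f - fps_deriv g.
Proof. by rewrite fps_derivD fps_derivN. Qed.

Lemma fps_derivM f g : fps_deriv (f * g) = fps_deriv f * g + f * fps_deriv g.
Proof.
apply: fps_ext => n; rewrite fps_coefD !fps_coefM /= -sumrMnl.
transitivity (\sum_(i < n.+2) (f i *+ i * g (n.+1 - i)%N
                            + f i * (g (n.+1 - i)%N *+ (n.+1 - i)))).
  apply: eq_bigr => i _; rewrite mulrnAl mulrnAr -mulrnDr subnKC //.
  by rewrite -ltnS.
rewrite big_split big_ord_recl /= mulr0n mul0r add0r; congr (_ + _).
rewrite big_ord_recr /= subnn mulr0n mulr0 addr0; apply: eq_bigr => i _.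
by rewrite subSn // -ltnS.
Qed.

Lemma fps_derivC c : fps_deriv c%:S = 0.
Proof. by apply: fps_ext => n /=; rewrite mul0rn. Qed.

Lemma fps_derivCM c f : fps_deriv (c%:S * f) = c%:S * fps_deriv f.
Proof. by rewrite fps_derivM fps_derivC mul0r add0r. Qed.

Lemma fps_deriv1 : fps_deriv 1 = 0.
Proof. by rewrite -fps_const1 fps_derivC. Qed.

Lemma fps_deriv_var : fps_deriv 't = 1.
Proof. by apply: fps_ext => -[|n] /=; rewrite ?mul0rn. Qed.

Lemma fps_deriv_varX2 : fps_deriv ('t ^+ 2) = 't *+ 2.
Proof. by rewrite expr2 fps_derivM fps_deriv_var mul1r mulr1. Qed.

(** The power rule is the common part of two chain rules: differentiation in t,
    below, and, over a ring of polynomials, differentiation of the coefficients. *)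
Lemma derivation_expr (D : fps K -> fps K) :
  D 1 = 0 -> (forall f g, D (f * g) = D f * g + f * D g) ->
  forall G k, D (G ^+ k.+1) = (G ^+ k * D G) *+ k.+1.
Proof.
move=> D1 DM G; elim=> [|k IH]; first by rewrite expr0 mul1r.
by rewrite exprS DM IH mulrnAr mulrA -exprS [D G * _]mulrC -mulrS.
Qed.

Lemma fps_deriv_comp F G : G 0%N = 0 ->
  fps_deriv (fps_comp F G) = fps_comp (fps_deriv F) G * fps_deriv G.
Proof.
move=> G0; apply: fps_ext => n; rewrite (fps_coef_compM _ _ G0 (ltnSn n)).
transitivity (fps_comp F G n.+1 *+ n.+1); first by [].
rewrite fps_coef_compE -sumrMnl big_ord_recl expr0 fps_coef1 mulr0 mul0rn add0r.
apply: eq_bigr => k _; rewrite lift0.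
rewrite -mulrnAr -[_ *+ n.+1]/(fps_deriv (G ^+ k.+1) n).
rewrite (derivation_expr fps_deriv1 fps_derivM) fps_coefMn.
by rewrite -[fps_deriv F k]/(F k.+1 *+ k.+1) mulrnAr mulrnAl.
Qed.

End FpsCalculus.

(** * Binomial powers and the logarithm through differential equations *)

Section FpsOde.
Variable K : comUnitRingType.
Hypothesis unitS : forall n, n.+1%:R \is a @GRing.unit K.
Implicit Types (f g y G H L : fps K).

(** The equation expresses (n + 1) y_(n+1) through the coefficients up to y_n. *)
Lemma fps_ode_uniq L y z : fps_deriv y = L * y -> fps_deriv z = L * z ->
  y 0%N = z 0%N -> y = z.
Proof.
move=> dy dz yz0; apply: fps_ext; elim/ltn_ind=> -[//|n] IH.
have /fpsP/(_ n) := dy; have /fpsP/(_ n) := dz; rewrite !fps_coefM /= => En Em.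
suff : y n.+1 *+ n.+1 = z n.+1 *+ n.+1.
  by rewrite -[LHS]mulr_natl -[RHS]mulr_natl => /(mulrI (unitS n)).
rewrite En Em; apply: eq_bigr => i _; congr (_ * _); apply: IH.
by rewrite ltnS leq_subr.
Qed.

Lemma fps_deriv_inj y z : fps_deriv y = fps_deriv z -> y 0%N = z 0%N -> y = z.
Proof.
move=> dE yz0; apply: fps_ext => -[//|n]; move/fpsP/(_ n): dE => /=.
by rewrite -[LHS]mulr_natl -[RHS]mulr_natl => /(mulrI (unitS n)).
Qed.

Lemma fps_unit1 G : G 0%N = 1 -> G \is a GRing.unit.
Proof. by move=> G0; rewrite fps_unitE G0 unitr1. Qed.

Lemma fps_power0 G a : fps_power G a 0%N = 1.
Proof. by rewrite fps_comp0 /= /pochhammer big_ord0 fact0 divr1. Qed.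

Lemma pochhammerS (a : K) n : pochhammer a n.+1 = pochhammer a n * (a + n%:R).
Proof. by rewrite /pochhammer big_ord_recr. Qed.

Lemma fact_unit n : n`!%:R \is a @GRing.unit K.
Proof.
by elim: n => [|n IH]; rewrite ?fact0 ?unitr1 // factS natrM unitrM unitS.
Qed.

(** The only fact about the binomial coefficients that is used: with the initial
    value 1, this equation determines the series. *)
Lemma fps_binomial_ode (a : K) :
  let b := Fps (fun n => pochhammer (- a) n / n`!%:R) in
  (1 - 't) * fps_deriv b = (- a)%:S * b.
Proof.
move=> b; apply: fps_ext => n; rewrite mulrBl mul1r fps_coefB fps_coefXM fps_coefCM.
have step m : b m.+1 *+ m.+1 = (- a + m%:R) * b m.
  rewrite /b /= pochhammerS factS natrM invrM ?fact_unit ?unitS //.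
  rewrite -mulr_natr -!mulrA mulVr ?unitS // mulr1.
  by rewrite mulrCA.
case: n => [|n]; first by rewrite subr0 [LHS]step addr0.
rewrite [fps_deriv b n.+1]step -[fps_deriv b n]/(b n.+1 *+ n.+1).
by rewrite mulrDl -[b n.+1 *+ _]mulr_natl addrK.
Qed.

Lemma fps_power_ode G a : G 0%N = 1 ->
  G * fps_deriv (fps_power G a) = a%:S * fps_deriv G * fps_power G a.
Proof.
move=> G0; have H0 : (1 - G) 0%N = 0 by rewrite fps_coefB G0 fps_coef1 subrr.
rewrite fps_deriv_comp // fps_derivB fps_deriv1 sub0r.
have := fps_binomial_ode a; set b := Fps _ => /= bE.
have : fps_comp ((1 - 't) * fps_deriv b) (1 - G) = fps_comp ((- a)%:S * b) (1 - G).
  by rewrite bE.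
rewrite mulrBl mul1r fps_compB fps_compXM // fps_compCM fps_constN => E.
rewrite -[fps_power G a]/(fps_comp b (1 - G)).
transitivity (- fps_deriv G * (fps_comp (fps_deriv b) (1 - G)
   - (1 - G) * fps_comp (fps_deriv b) (1 - G))); first by ring.
by rewrite E; ring.
Qed.

(** The laws of exponents below follow from this characterization: each product
    or iterated power solves the equation of the power it should equal. *)
Lemma fps_powerP G a y : G 0%N = 1 -> y 0%N = 1 ->
  G * fps_deriv y = a%:S * fps_deriv G * y -> y = fps_power G a.
Proof.
move=> G0 y0 yE; have uG := fps_unit1 G0.
apply: (@fps_ode_uniq (G^-1 * (a%:S * fps_deriv G))).
- by apply: (mulrI uG); rewrite yE !mulrA divrr // mul1r.
- by apply: (mulrI uG); rewrite fps_power_ode // !mulrA divrr // mul1r.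
- by rewrite y0 fps_power0.
Qed.

Lemma fps_powerM G H a : G 0%N = 1 -> H 0%N = 1 ->
  fps_power (G * H) a = fps_power G a * fps_power H a.
Proof.
move=> G0 H0; symmetry; apply: fps_powerP.
- by rewrite fps_coefM0 G0 H0 mulr1.
- by rewrite fps_coefM0 !fps_power0 mulr1.
have EG := fps_power_ode a G0; have EH := fps_power_ode a H0.
rewrite !fps_derivM; move: EG EH.
move: (fps_power G a) (fps_power H a) => y z EG EH.
transitivity (H * z * (G * fps_deriv y) + G * y * (H * fps_deriv z)).
  by ring.
by rewrite EG EH; ring.
Qed.

Lemma fps_powerD G a b : G 0%N = 1 ->
  fps_power G (a + b) = fps_power G a * fps_power G b.
Proof.
move=> G0; symmetry; apply: fps_powerP => //.
  by rewrite fps_coefM0 !fps_power0 mulr1.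
have Ea := fps_power_ode a G0; have Eb := fps_power_ode b G0.
rewrite !fps_derivM fps_constD; move: Ea Eb.
move: (fps_power G a) (fps_power G b) => y z Ea Eb.
transitivity (z * (G * fps_deriv y) + y * (G * fps_deriv z)); first by ring.
by rewrite Ea Eb; ring.
Qed.

Lemma fps_power_id G : G 0%N = 1 -> fps_power G 1 = G.
Proof.
by move=> G0; symmetry; apply: fps_powerP => //; rewrite fps_const1 mul1r mulrC.
Qed.

Lemma fps_power_power G a b : G 0%N = 1 ->
  fps_power (fps_power G a) b = fps_power G (a * b).
Proof.
move=> G0; have y0 := fps_power0 G a.
apply: (fps_powerP G0); first exact: fps_power0.
have Ea := fps_power_ode a G0; have Eb := fps_power_ode b y0.
apply: (mulrI (fps_unit1 y0)); rewrite fps_constM; move: Ea Eb.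
move: (fps_power _ b) => z; move: (fps_power G a) => y Ea Eb.
transitivity (G * (y * fps_deriv z)); first by ring.
rewrite Eb; transitivity (b%:S * z * (G * fps_deriv y)); first by ring.
by rewrite Ea; ring.
Qed.

Lemma fps_ln_ode G : G 0%N = 1 -> G * fps_deriv (fps_ln G) = fps_deriv G.
Proof.
move=> G0; have H0 : (1 - G) 0%N = 0 by rewrite fps_coefB G0 fps_coef1 subrr.
rewrite /fps_ln; set b := Fps _; rewrite fps_deriv_comp //.
have bE : (1 - 't) * fps_deriv b = -1.
  apply: fps_ext => n; rewrite mulrBl mul1r fps_coefB fps_coefXM fps_coefN fps_coef1.
  have db m : fps_deriv b m = -1 by rewrite /= mulNrn -[_ *+ _]mulr_natr mulVr ?unitS.
  by case: n => [|n]; rewrite !db ?subr0 ?subrr ?oppr0.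
have : fps_comp ((1 - 't) * fps_deriv b) (1 - G) = -1.
  by rewrite bE fps_compN fps_comp_one.
rewrite mulrBl mul1r fps_compB fps_compXM // => E.
rewrite fps_derivB fps_deriv1 sub0r.
transitivity (- fps_deriv G * (fps_comp (fps_deriv b) (1 - G)
   - (1 - G) * fps_comp (fps_deriv b) (1 - G))); first by ring.
by rewrite E; ring.
Qed.

End FpsOde.

(** * Power series with coefficients in C[x] *)

Section Lift.
Variable R : realType.
Local Notation C := R[i].
Implicit Types (f g : fps C) (F G : fps {poly C}).

Lemma complex_unitS n : n.+1%:R \is a @GRing.unit C.
Proof. by rewrite unitfE pnatr_eq0. Qed.

Lemma poly_unitS n : n.+1%:R \is a @GRing.unit {poly C}.
Proof. by rewrite -polyC_natr rmorph_unit ?complex_unitS. Qed.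

Fact fps_lift_is_zmod_morphism : zmod_morphism (@fps_lift R).
Proof. by move=> f g; apply: fps_ext => n /=; rewrite polyCB. Qed.

Fact fps_lift_is_monoid_morphism : monoid_morphism (@fps_lift R).
Proof.
split=> [|f g]; apply: fps_ext => n.
  by rewrite [LHS]polyC_natr.
rewrite fps_coefM -[LHS]/(((f * g) n)%:P) fps_coefM rmorph_sum.
by apply: eq_bigr => i _; rewrite rmorphM.
Qed.

HB.instance Definition _ :=
  GRing.isZmodMorphism.Build _ _ (@fps_lift R) fps_lift_is_zmod_morphism.
HB.instance Definition _ :=
  GRing.isMonoidMorphism.Build _ _ (@fps_lift R) fps_lift_is_monoid_morphism.

Lemma fps_lift1 : fps_lift 1 = 1 :> fps {poly C}.
Proof. exact: rmorph1. Qed.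

Lemma fps_lift_nat n : fps_lift n%:R = n%:R :> fps {poly C}.
Proof. exact: rmorph_nat. Qed.

Lemma fps_liftD f g : fps_lift (f + g) = fps_lift f + fps_lift g.
Proof. exact: rmorphD. Qed.

Lemma fps_liftN f : fps_lift (- f) = - fps_lift f.
Proof. exact: rmorphN. Qed.

Lemma fps_liftB f g : fps_lift (f - g) = fps_lift f - fps_lift g.
Proof. exact: rmorphB. Qed.

Lemma fps_liftM f g : fps_lift (f * g) = fps_lift f * fps_lift g.
Proof. exact: rmorphM. Qed.

Lemma fps_liftX f n : fps_lift (f ^+ n) = fps_lift f ^+ n.
Proof. exact: rmorphXn. Qed.

Lemma fps_liftC c : fps_lift (c%:S) = c%:P%:S :> fps {poly C}.
Proof. by apply: fps_ext => -[|n]. Qed.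

Lemma fps_lift_var : fps_lift 't = 't :> fps {poly C}.
Proof. by apply: fps_ext => n /=; rewrite polyC_natr. Qed.

Lemma fps_lift_deriv f : fps_lift (fps_deriv f) = fps_deriv (fps_lift f).
Proof. by apply: fps_ext => n /=; rewrite polyCMn. Qed.

Lemma fps_lift_power f a : f 0%N = 1 ->
  fps_lift (fps_power f a) = fps_power (fps_lift f) a%:P.
Proof.
move=> f0; apply: (fps_powerP poly_unitS).
- by rewrite /= f0.
- by rewrite -[LHS]/((fps_power f a 0%N)%:P) fps_power0.
by rewrite -!fps_lift_deriv -rmorphM fps_power_ode // ?rmorphM /= ?fps_liftC //;
  exact: complex_unitS.
Qed.

Definition fps_dx G : fps {poly C} := Fps (fun n => (G n)^`()).

Lemma fps_dxM F G : fps_dx (F * G) = fps_dx F * G + F * fps_dx G.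
Proof.
apply: fps_ext => n; rewrite fps_coefD !fps_coefM -big_split.
rewrite -[LHS]/(((F * G) n)^`()) fps_coefM raddf_sum.
by apply: eq_bigr => i _; rewrite /= derivM.
Qed.

Lemma fps_dx1 : fps_dx 1 = 0.
Proof. by apply: fps_ext => n; rewrite /= -polyC_natr derivC. Qed.

Lemma fps_dxB F G : fps_dx (F - G) = fps_dx F - fps_dx G.
Proof. by apply: fps_ext => n; rewrite /= derivB. Qed.

Lemma fps_dx_lift f : fps_dx (fps_lift f) = 0.
Proof. by apply: fps_ext => n; rewrite /= derivC. Qed.

Lemma fps_dxX : fps_dx 'X%:S = 1.
Proof. by apply: fps_ext => -[|n]; rewrite /= ?derivX ?derivC. Qed.

Lemma fps_dx_comp f G : G 0%N = 0 ->
  fps_dx (fps_comp (fps_lift f) G)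
  = fps_comp (fps_lift (fps_deriv f)) G * fps_dx G.
Proof.
move=> G0; apply: fps_ext => n; rewrite (fps_coef_compM _ _ G0 (ltnSn n)).
rewrite -[LHS]/((fps_comp (fps_lift f) G n)^`()).
rewrite (fps_coef_comp _ G0 (ltnW (ltnSn n.+1))) raddf_sum big_ord_recl.
rewrite expr0 fps_coef1 /= -polyC_natr -polyCM derivC add0r.
apply: eq_bigr => k _.
rewrite /bump add1n derivM derivC mul0r add0r.
rewrite -[_^`()]/(fps_dx (G ^+ k.+1) n) (derivation_expr fps_dx1 fps_dxM).
by rewrite fps_coefMn /= polyCMn mulrnAr mulrnAl.
Qed.

End Lift.

(** * The relations satisfied by a generating function *)

Section Relations.
Variable R : realType.
Local Notation C := R[i].
Implicit Types (P : nat -> {poly C}) (d : genfun R).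

Definition log_deriv_A d : fps C := fps_deriv (gf_A d) / gf_A d.
Definition deriv_R_over_A d : fps C := fps_deriv (gf_R d) / gf_A d.

(** Both G_t and G_x are combinations of F(H) and F'(H), where H = xtA - R:
    G_t = A' F(H) + A H_t F'(H) and G_x = t A^2 F'(H).  Eliminating the two
    composites leaves an equation whose unknowns L and Q enter linearly. *)
Lemma genfun_pde P d : is_genfun P d ->
  let G := weighted_series (gf_alpha d) P in
  let L := fps_lift (log_deriv_A d) in
  't * fps_deriv G = 't * (L * G)
    + 'X%:S * (fps_dx G + 't * (L * fps_dx G))
    - fps_lift (deriv_R_over_A d) * fps_dx G.
Proof.
case=> _ _ _ [A0 R0]; set H := (_ - _) => <- /=; set A := fps_lift (gf_A d).
have H0 : H 0%N = 0.
  by rewrite fps_coefB !fps_coefM0 /= R0 mulr0 mul0r subr0.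
set L := fps_lift (log_deriv_A d); set Q := fps_lift (deriv_R_over_A d).
have LA : fps_deriv A = L * A.
  by rewrite -fps_lift_deriv -rmorphM /log_deriv_A divrK ?fps_unit1.
have QA : fps_deriv (fps_lift (gf_R d)) = Q * A.
  by rewrite -fps_lift_deriv -rmorphM /deriv_R_over_A divrK ?fps_unit1.
rewrite fps_dxM fps_dx_lift mul0r add0r fps_dx_comp //.
rewrite fps_derivM fps_deriv_comp // -fps_lift_deriv LA.
have -> : fps_deriv H = 'X%:S * (A + 't * (L * A)) - Q * A.
  rewrite fps_derivB QA !fps_derivM fps_derivC fps_deriv_var LA.
  by ring.
have -> : fps_dx H = 't * A.
  have dt : fps_dx 't = 0 :> fps {poly C} by rewrite -fps_lift_var fps_dx_lift.
  by rewrite fps_dxB !fps_dxM !fps_dx_lift fps_dxX dt !mulr0 subr0 !addr0 mul1r.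
move: (fps_comp _ _) (fps_comp _ _) => Fc Fc'.
move: ('X%:S) L Q A {LA QA H0 H} => X L Q A.
ring.
Qed.

Definition gf_coef P d m j : C := gf_alpha d m * (P m)`_j.

Lemma gf_coef_gt P d m j : is_genfun P d -> (m < j)%N -> gf_coef P d m j = 0.
Proof.
by case=> mP _ _ _ _ mj; rewrite /gf_coef nth_default ?mulr0 // (mP m).2.
Qed.

Lemma gf_coef_diag P d m : is_genfun P d -> gf_coef P d m m = gf_alpha d m.
Proof.
case=> mP _ _ _ _; have [/monicP lc sz] := mP m.
by rewrite /gf_coef; move: lc; rewrite lead_coefE sz /= => ->; rewrite mulr1.
Qed.

(** The coefficient of x^j t^(n+1) in the differential equation. *)
Lemma genfun_coef P d n j : is_genfun P d ->
  (n.+1%:R - j%:R) * gf_coef P d n.+1 j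
  = j.+1%:R * \sum_(k < n.+1)
      (log_deriv_A d k * gf_coef P d (n - k) j
       - deriv_R_over_A d k * gf_coef P d (n - k).+1 j.+1).
Proof.
move=> gd; have := genfun_pde gd.
set G := weighted_series _ _; set L := log_deriv_A d; set Q := deriv_R_over_A d.
have GE m i : (G m)`_i = gf_coef P d m i by rewrite /= coefZ.
move=> /= /fpsP/(_ n.+1)/(congr1 (fun p : {poly C} => p`_j)).
rewrite fps_coefXM fps_coefB fps_coefD fps_coefXM fps_coefCM fps_coefD fps_coefXM.
rewrite !fps_coefM [X in _ - X]big_ord_recr.
have -> : (fps_dx G (n.+1 - n.+1)%N) = 0.
  rewrite subnn [fps_dx G 0%N]/= derivZ.
  have [mP _ _ _ _] := gd; have [_ /eqP/size_poly1P[c _ ->]] := mP 0%N.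
  by rewrite derivC scaler0.
rewrite mulr0 [X in _ - X]addr0 coefB coefD mulrDr coefD.
have dxE p : ('X * p^`())`_j = j%:R * p`_j :> C.
  rewrite coefXM; case: j => [|i] /=; first by rewrite mul0r.
  by rewrite coef_deriv mulr_natl.
rewrite [('X * fps_dx G n.+1)`_j]dxE GE.
rewrite [('X * _)`_j](_ : _ = \sum_(k < n.+1) L k * (j%:R * gf_coef P d (n - k) j)); last first.
  rewrite mulr_sumr coef_sum; apply: eq_bigr => k _.
  rewrite mulrCA [fps_lift L k]/= coefCM [fps_dx G _]/= dxE.
  by rewrite -/(G (n - k)%N) GE.
rewrite (_ : (fps_deriv G n)`_j = n.+1%:R * gf_coef P d n.+1 j); last first.
  by rewrite [fps_deriv G n]/= coefMn -GE mulr_natl.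
rewrite !coef_sum.
rewrite (eq_bigr (fun k : 'I_n.+1 => L k * gf_coef P d (n - k) j)); last first.
  by move=> k _; rewrite [fps_lift L k]/= coefCM GE.
rewrite [X in _ - X](eq_bigr (fun k : 'I_n.+1 => Q k * (j.+1%:R * gf_coef P d (n - k).+1 j.+1))); last first.
  move=> k _; rewrite [fps_lift Q k]/= coefCM [fps_dx G _]/= coef_deriv.
  by rewrite -/(G (n.+1 - k)%N) GE subSn ?mulr_natl //= -ltnS.
rewrite mulrBl sumrB => ->.
under [X in _ + (_ + X)]eq_bigr do rewrite mulrCA.
under [X in _ - X - _]eq_bigr do rewrite mulrCA.
rewrite -!mulr_sumr -(natr1 j).
move: (\sum_(i < _) _) (\sum_(i < _) _) => S1 S2.
by ring.
Qed.

(** For n = j + i the terms with k > i vanish, as P_m has degree m < j there. *)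
Lemma genfun_coef_add P d i j : is_genfun P d ->
  i.+1%:R * gf_coef P d (j + i).+1 j
  = j.+1%:R * \sum_(k < i.+1)
      (log_deriv_A d k * gf_coef P d (j + (i - k)) j
       - deriv_R_over_A d k * gf_coef P d (j + (i - k)).+1 j.+1).
Proof.
move=> gd; have := genfun_coef (j + i) j gd.
rewrite -addnS natrD addrC addKr => ->; congr (_ * _).
pose F k := log_deriv_A d k * gf_coef P d (j + i - k) j
       - deriv_R_over_A d k * gf_coef P d (j + i - k).+1 j.+1.
rewrite addnS -[LHS]/(\sum_(k < (j + i).+1) F k).
transitivity (\sum_(k < i.+1) F k); last first.
  by apply: eq_bigr => k _; rewrite /F addnBA // -ltnS.
have le_i : (i.+1 <= (j + i).+1)%N by rewrite ltnS leq_addl.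
rewrite (big_ord_widen _ F le_i) [RHS]big_mkcond; apply: eq_bigr => k _.
case: ltnP => // ik; have ltj : (j + i - k < j)%N.
  have := ltn_ord k; rewrite ltnS => kji.
  by rewrite ltn_subLR // [(k + j)%N]addnC ltn_add2l.
by rewrite /F !(gf_coef_gt gd) ?ltnS // !mulr0 subr0.
Qed.

(** The last term of the sum isolated: L_i and Q_i are the unknowns that step i
    adds to those of the previous steps. *)
Lemma genfun_coef_addS P d i j : is_genfun P d ->
  j.+1%:R * (log_deriv_A d i * gf_alpha d j
             - deriv_R_over_A d i * gf_alpha d j.+1)
  = i.+1%:R * gf_coef P d (j + i).+1 j
  - j.+1%:R * \sum_(k < i)
      (log_deriv_A d k * gf_coef P d (j + (i - k)) j
       - deriv_R_over_A d k * gf_coef P d (j + (i - k)).+1 j.+1).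
Proof.
move=> gd; rewrite (genfun_coef_add _ _ gd) big_ord_recr subnn addn0 !gf_coef_diag //.
by rewrite [in RHS]mulrDr [RHS]addrAC subrr add0r.
Qed.

Definition geometric (a : nat -> C) := forall n, a n = a 1%N ^+ n.

Lemma geometricP (a : nat -> C) x : a 0%N = 1 ->
  (forall n, a n.+1 = x * a n) -> geometric a.
Proof.
move=> a0 aS; have x1 : a 1%N = x by rewrite aS a0 mulr1.
by elim=> [|n IH]; rewrite ?a0 ?expr0 // aS IH exprS x1.
Qed.

(** Geometric weights are the one obstruction to uniqueness: for them F is
    1 / (1 - alpha_1 t), and L_i alpha_j = Q_i alpha_(j+1) has solutions other
    than 0. *)
Lemma proportional_shift (a : nat -> C) (u v : C) : a 0%N = 1 ->
  (forall n, u * a n = v * a n.+1) -> ~ geometric a -> u = 0 /\ v = 0.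
Proof.
move=> a0 uv ng; have [v0|v0] := eqVneq v 0.
  by split=> //; have := uv 0%N; rewrite a0 mulr1 v0 mul0r.
case: ng; apply: (@geometricP _ (v^-1 * u)) => // n.
by rewrite -mulrA uv mulKf.
Qed.

(** By induction on i the differences u of the L_i and v of the Q_i satisfy
    u alpha_j = v alpha_(j+1) for all j.  This forces u = v = 0 if the weights are
    not geometric; if the series A agree then u = 0 is known, and v = 0 follows. *)
Lemma genfun_uniq P d d' : is_genfun P d -> is_genfun P d' ->
  gf_alpha d = gf_alpha d' ->
  ~ geometric (gf_alpha d) \/ gf_A d = gf_A d' -> d = d'.
Proof.
move=> gd gd' aE hyp; have [_ [a0 an] FE [A0 R0] _] := gd.
have [_ [a0' _] FE' [A0' R0'] _] := gd'.
have coefE m j : gf_coef P d m j = gf_coef P d' m j by rewrite /gf_coef aE.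
have LQ i : log_deriv_A d i = log_deriv_A d' i
         /\ deriv_R_over_A d i = deriv_R_over_A d' i.
  elim/ltn_ind: i => i IH.
  (* Step i for d minus step i for d': the earlier terms cancel. *)
  have diff j : (log_deriv_A d i - log_deriv_A d' i) * gf_alpha d j
      = (deriv_R_over_A d i - deriv_R_over_A d' i) * gf_alpha d j.+1.
    have : j.+1%:R * (log_deriv_A d i * gf_alpha d j
                - deriv_R_over_A d i * gf_alpha d j.+1)
      = j.+1%:R * (log_deriv_A d' i * gf_alpha d j
                - deriv_R_over_A d' i * gf_alpha d j.+1).
      rewrite (genfun_coef_addS _ _ gd) [in RHS]aE (genfun_coef_addS _ _ gd') coefE.
      congr (_ - _ * _); apply: eq_bigr => k _.
      by have [-> ->] := IH k (ltn_ord k); rewrite !coefE.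
    move/(mulrI (complex_unitS R j)) => E; apply/eqP; rewrite -subr_eq0; apply/eqP.
    by transitivity ((log_deriv_A d i * gf_alpha d j
                - deriv_R_over_A d i * gf_alpha d j.+1)
       - (log_deriv_A d' i * gf_alpha d j
                - deriv_R_over_A d' i * gf_alpha d j.+1));
      [ring | rewrite E subrr].
  case: hyp => [ng|AE].
    have [u0 v0] := proportional_shift a0 diff ng.
    by split; apply/eqP; rewrite -subr_eq0 ?u0 ?v0.
  have LE : log_deriv_A d i = log_deriv_A d' i by rewrite /log_deriv_A AE.
  split=> //; have := diff 0%N; rewrite LE subrr mul0r => /esym/eqP.
  by rewrite mulf_eq0 (negPf (an 1%N)) orbF subr_eq0 => /eqP.
have LE : log_deriv_A d = log_deriv_A d'.
  by apply: fps_ext => i; have [] := LQ i.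
have QE : deriv_R_over_A d = deriv_R_over_A d'.
  by apply: fps_ext => i; have [] := LQ i.
have uA : gf_A d \is a GRing.unit by exact: fps_unit1.
have uA' : gf_A d' \is a GRing.unit by exact: fps_unit1.
have AE : gf_A d = gf_A d'.
  apply: (fps_ode_uniq (@complex_unitS R) (L := log_deriv_A d)).
  - by rewrite /log_deriv_A divrK.
  - by rewrite LE /log_deriv_A divrK.
  - by rewrite A0 A0'.
have RE : gf_R d = gf_R d'.
  apply: (fps_deriv_inj (@complex_unitS R)); last by rewrite R0 R0'.
  have := congr1 ( *%R^~ (gf_A d)) QE.
  by rewrite /deriv_R_over_A divrK // AE divrK.
by case: (d) (d') aE AE RE FE FE' => [a A r F] [a' A' r' F'] /= -> -> -> -> ->.
Qed.
End Relations.

(** * The leading coefficients of the Gegenbauer polynomials *)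

(* Closes side conditions of [field] that equal a hypothesis up to [ring]. *)
Ltac nonzero :=
  repeat (apply/andP; split);
  match goal with
  | H : is_true (?f != 0) |- is_true (?e != 0) =>
      by rewrite (_ : e = f); [exact: H | ring]
  | |- _ => by rewrite ?pnatr_eq0
  end.

Section GegenbauerCoef.
Variables (K : numFieldType) (lambda : K).

Lemma gegenbauer_monic n :
  gegenbauer lambda n \is monic /\ size (gegenbauer lambda n) = n.+1.
Proof.
suff [] : (gegenbauer lambda n \is monic /\ size (gegenbauer lambda n) = n.+1) /\
  (gegenbauer lambda n.+1 \is monic /\ size (gegenbauer lambda n.+1) = n.+2) by [].
elim: n => [|n [[_ sn] [m1 s1]]].
  by rewrite gegenbauer0 gegenbauer1 monic1 monicX size_poly1 size_polyX.
split; first by split.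
have sX : size ('X * gegenbauer lambda n.+1) = n.+3.
  by rewrite mulrC size_mulX ?s1 // -size_poly_gt0 s1.
have lt : (size (- (gegenbauer_omega lambda n.+1 *: gegenbauer lambda n))
           < size ('X * gegenbauer lambda n.+1)%R)%N.
  rewrite sX size_polyN; apply: leq_ltn_trans (size_scale_leq _ _) _.
  by rewrite sn ltnS.
rewrite gegenbauerS size_polyDl // sX; split=> //.
by rewrite monicE lead_coefDl // lead_coefM lead_coefX mul1r -monicE.
Qed.

Lemma gegenbauer_coef_diag n : (gegenbauer lambda n)`_n = 1.
Proof.
by have [/monicP + sn] := gegenbauer_monic n; rewrite lead_coefE sn.
Qed.

Lemma gegenbauer_coefSS n j : (gegenbauer lambda n.+2)`_j =
  (if j is i.+1 then (gegenbauer lambda n.+1)`_i else 0)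
  - gegenbauer_omega lambda n.+1 * (gegenbauer lambda n)`_j.
Proof. by rewrite gegenbauerS coefB coefXM coefZ; case: j. Qed.

Lemma gegenbauer_coef1 n : (gegenbauer lambda n.+1)`_n = 0.
Proof.
elim: n => [|n IH]; first by rewrite gegenbauer1 coefX.
rewrite gegenbauer_coefSS IH nth_default ?mulr0 ?subr0 //.
by rewrite (gegenbauer_monic n).2.
Qed.

Lemma gegenbauer_coef3 n : (gegenbauer lambda n.+3)`_n = 0.
Proof.
elim: n => [|n IH]; first by rewrite gegenbauer_coefSS gegenbauer_coef1 mulr0 subr0.
by rewrite gegenbauer_coefSS IH gegenbauer_coef1 mulr0 subr0.
Qed.

Hypothesis lambda_neq : forall m, lambda + m.+1%:R != 0.

Lemma gegenbauer_omegaSS n : gegenbauer_omega lambda n.+2 =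
  (n%:R + 2) * (n%:R + 1 + 2 * lambda)
  / (4 * (n%:R + 2 + lambda) * (n%:R + 1 + lambda)).
Proof.
rewrite /gegenbauer_omega /= -(natr1 n.+1) addrK -(natr1 n).
by rewrite (_ : n%:R + 1 + 1 = n%:R + 2) //; ring.
Qed.

Lemma lambda_neq1 n : n%:R + 1 + lambda != 0.
Proof. by rewrite natr1 addrC. Qed.

Lemma lambda_neq2 n : n%:R + 2 + lambda != 0.
Proof. by rewrite -natrD addn2 addrC. Qed.

Lemma lambda_neq3 n : n%:R + 3 + lambda != 0.
Proof. by rewrite -natrD addn3 addrC. Qed.

Lemma lambda_neq4 n : n%:R + 4 + lambda != 0.
Proof. by rewrite -natrD addn4 addrC. Qed.

Lemma gegenbauer_coef2 n : (gegenbauer lambda n.+2)`_n =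
  - ((n%:R + 2) * (n%:R + 1) / (4 * (n%:R + 1 + lambda))).
Proof.
elim: n => [|n IH]; rewrite gegenbauer_coefSS gegenbauer_coef_diag mulr1.
  have l1 : lambda + 1 != 0 := lambda_neq 0.
  by rewrite sub0r /gegenbauer_omega /=; field; rewrite addrC l1.
rewrite IH gegenbauer_omegaSS -natr1.
have l1 := lambda_neq1 n; have l2 := lambda_neq2 n.
by field; nonzero.
Qed.

Lemma gegenbauer_coef4 n : (gegenbauer lambda n.+4)`_n =
  (n%:R + 4) * (n%:R + 3) * (n%:R + 2) * (n%:R + 1)
  / (32 * (n%:R + 3 + lambda) * (n%:R + 2 + lambda)).
Proof.
elim: n => [|n IH]; rewrite gegenbauer_coefSS gegenbauer_coef2.
  rewrite gegenbauer_omegaSS.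
  have l1 := lambda_neq1 0; have l2 := lambda_neq2 0; have l3 := lambda_neq3 0.
  rewrite !add0r in l1 l2 l3.
  by field; nonzero.
rewrite IH gegenbauer_omegaSS -natr1 -(natr1 n.+1) -(natr1 n).
have l2 := lambda_neq2 n; have l3 := lambda_neq3 n; have l4 := lambda_neq4 n.
by field; nonzero.
Qed.

End GegenbauerCoef.

(** * The weights determined by the first and third relations *)

Section CubicVanishing.
Variable K : numFieldType.

(** Taking finite differences at y, y + 1, y + 2, y + 3 isolates the coefficients
    one after the other, from the top. *)
Lemma cubic_eq0 (c3 c2 c1 c0 y : K) :
  (forall j : nat, let z := y + j%:R in
     c3 * z ^+ 3 + c2 * z ^+ 2 + c1 * z + c0 = 0) ->
  [/\ c3 = 0, c2 = 0, c1 = 0 & c0 = 0].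
Proof.
move=> /= h; have nz k : k.+1%:R != 0 :> K by rewrite pnatr_eq0.
have h0 := h 0%N; have h1 := h 1%N; have h2 := h 2%N; have h3 := h 3%N.
have e3 : c3 = 0.
  apply: (mulfI (nz 5%N)); rewrite mulr0.
  by transitivity ((c3 * (y + 3) ^+ 3 + c2 * (y + 3) ^+ 2 + c1 * (y + 3) + c0)
    - 3 * (c3 * (y + 2) ^+ 3 + c2 * (y + 2) ^+ 2 + c1 * (y + 2) + c0)
    + 3 * (c3 * (y + 1) ^+ 3 + c2 * (y + 1) ^+ 2 + c1 * (y + 1) + c0)
    - (c3 * (y + 0) ^+ 3 + c2 * (y + 0) ^+ 2 + c1 * (y + 0) + c0));
    [ring | rewrite h0 h1 h2 h3; ring].
rewrite e3 !mul0r !add0r in h0 h1 h2.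
have e2 : c2 = 0.
  apply: (mulfI (nz 1%N)); rewrite mulr0.
  by transitivity ((c2 * (y + 2) ^+ 2 + c1 * (y + 2) + c0)
    - 2 * (c2 * (y + 1) ^+ 2 + c1 * (y + 1) + c0)
    + (c2 * (y + 0) ^+ 2 + c1 * (y + 0) + c0));
    [ring | rewrite h0 h1 h2; ring].
rewrite e2 !mul0r !add0r in h0 h1.
have e1 : c1 = 0.
  transitivity ((c1 * (y + 1) + c0) - (c1 * (y + 0) + c0)); first by ring.
  by rewrite h0 h1 subrr.
by split=> //; rewrite e1 mul0r add0r in h0.
Qed.

End CubicVanishing.

Section Sequences.
Variables (K : numFieldType) (lambda : K) (alpha : nat -> K) (l1 q1 l3 q3 : K).
Hypothesis lambda_neq : forall m, lambda + m.+1%:R != 0.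
Hypothesis alpha_neq0 : forall n, alpha n != 0.
Hypothesis rec1 : forall j, (j%:R + 2) * alpha j.+2
  = 2 * (j%:R + 1 + lambda) * (q1 * alpha j.+1 - l1 * alpha j).
Hypothesis rec3 : forall j, l1 * gegenbauer_omega lambda j.+2 * alpha j.+2
  = q3 * alpha j.+1 - l3 * alpha j.
Hypothesis l1_neq0 : l1 != 0.
Hypothesis lambda1 : lambda != 1.
Hypothesis nongeometric : ~ (exists x, forall n, alpha n.+1 = x * alpha n).

(** Eliminating alpha_(j+2) from the two relations gives, at y = j + 2 + lambda,
      alpha_j (A y - B) = alpha_(j+1) (C y - D)
    with the constants of the proof.  Inserting this twice into the first relation
    yields [cubic]; it holds for all j, so both sides agree as polynomials in y.
    Their values at y = 0 show that A = B or lambda = 0, and if A is not B those at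
    y = 1 show that B = 2 A.  If A = B the ratio is the announced one, and lambda is
    not 0, or else the weights would be geometric.  If B = 2 A and lambda = 0, then
    D = 3 C, and for j = 0 the relation reads 0 = - alpha_1 C, while C is not 0. *)
Lemma alpha_ratio : lambda != 0 /\
  exists2 c, c != 0 & forall j,
    (j%:R + 1) * alpha j.+1 = c * (j%:R + 1 + lambda) * alpha j.
Proof.
set A := 2 * l3 - l1 ^+ 2; set B := l1 ^+ 2 * (lambda - 1).
set C := 2 * q3 - l1 * q1; set D := l1 * q1 * (lambda - 1).
set E := q1 * A - l1 * C.
have two0 : 2 != 0 :> K by rewrite pnatr_eq0.
have B0 : B != 0 by rewrite mulf_neq0 ?expf_neq0 // subr_eq0.
pose y j : K := j%:R + 2 + lambda.
have y0 j : y j != 0 by exact: lambda_neq2.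
have mobius j : alpha j * (A * y j - B) = alpha j.+1 * (C * y j - D).
  have yj := y0 j; have yj1 := lambda_neq1 lambda_neq j; rewrite /y in yj.
  have e1 := rec1 j; have e3 := rec3 j; rewrite gegenbauer_omegaSS // in e3.
  have e : 2 * (j%:R + 2 + lambda) * (q3 * alpha j.+1 - l3 * alpha j)
    = l1 * (j%:R + 1 + 2 * lambda) * (q1 * alpha j.+1 - l1 * alpha j).
    rewrite -e3; transitivity (l1 * (j%:R + 1 + 2 * lambda) *
      ((j%:R + 2) * alpha j.+2) / (2 * (j%:R + 1 + lambda))).
      by field; nonzero.
    by rewrite e1; field; nonzero.
  apply/eqP; rewrite -subr_eq0 -oppr_eq0; apply/eqP.
  transitivity (2 * (j%:R + 2 + lambda) * (q3 * alpha j.+1 - l3 * alpha j)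
    - l1 * (j%:R + 1 + 2 * lambda) * (q1 * alpha j.+1 - l1 * alpha j)).
    by rewrite /A /B /C /D /y; ring.
  by rewrite e subrr.
have cubic j : (y j - lambda) * (A * y j - B) * (A * (y j + 1) - B)
  = 2 * (y j - 1) * y j * E * (C * (y j + 1) - D).
  apply: (mulfI (alpha_neq0 j.+2)).
  have m1 := mobius j; have m2 := mobius j.+1.
  have e1 := rec1 j; rewrite (_ : y j.+1 = y j + 1) in m2; last first.
    by rewrite /y -natr1; ring.
  transitivity ((A * y j - B) * (A * (y j + 1) - B) * ((j%:R + 2) * alpha j.+2)).
    by rewrite /y; ring.
  rewrite e1.
  transitivity (2 * (y j - 1) * (A * (y j + 1) - B) * 
    (q1 * (A * y j - B) * alpha j.+1 - l1 * (alpha j * (A * y j - B)))).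
    by rewrite /y; ring.
  rewrite m1.
  transitivity (2 * (y j - 1) * E * y j * (alpha j.+1 * (A * (y j + 1) - B))).
    by rewrite /E /B /D; ring.
  by rewrite m2; ring.
have [] := @cubic_eq0 _ (A ^+ 2 - 2 * E * C)
  (A * (A - B) - A * B - lambda * A ^+ 2 + 2 * E * D)
  (- B * (A - B) - lambda * (A * (A - B) - A * B) + 2 * E * (C - D))
  (lambda * B * (A - B)) (2 + lambda).
  move=> j /=; rewrite (_ : 2 + lambda + j%:R = y j); last by rewrite /y; ring.
  transitivity ((y j - lambda) * (A * y j - B) * (A * (y j + 1) - B)
    - 2 * (y j - 1) * y j * E * (C * (y j + 1) - D)); first by ring.
  by rewrite cubic subrr.
move=> /subr0_eq c3 c2 c1 /eqP c0.
have {c0} : (lambda == 0) || (A - B == 0).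
  by move: c0; rewrite mulf_eq0 [_ * B == 0]mulf_eq0 (negPf B0) orbF.
(* The constant term is lambda B (A - B). *)
have [AB _|AB] := eqVneq A B.
  have E0 : E != 0.
    apply: contra_neq B0 => E0; move: c3; rewrite AB E0 !(mulr0, mul0r).
    by move/eqP; rewrite expf_eq0 /= => /eqP.
  have C0 : C != 0.
    apply: contra_neq B0 => C0; move: c3; rewrite AB C0 !(mulr0, mul0r).
    by move/eqP; rewrite expf_eq0 /= => /eqP.
  have CD : C - D = - lambda * C.
    have E2 : 2 * E != 0 by rewrite mulf_neq0.
    apply: (mulfI E2); rewrite AB subrr !mulr0 !add0r in c1 c3.
    apply/eqP; rewrite -subr_eq0 -c1; apply/eqP.
    transitivity (2 * E * (C - D) + lambda * (2 * E * C)); first by ring.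
    by rewrite -c3; ring.
  have ratio j : (j%:R + 1) * alpha j.+1 = B / C * (j%:R + 1 + lambda) * alpha j.
    have m := mobius j; apply: (mulfI C0); rewrite -AB.
    transitivity (alpha j.+1 * (C * y j - C + (C - D) - - lambda * C - lambda * C)).
      by rewrite CD /y; ring.
    transitivity (alpha j.+1 * (C * y j - D)); first by ring.
    by rewrite -m -AB /y; field.
  have l0 : lambda != 0.
    apply: contra_notN nongeometric => /eqP l0; exists (B / C) => n.
    have n1 : n%:R + 1 != 0 :> K by rewrite natr1 pnatr_eq0.
    by apply: (mulfI n1); rewrite ratio l0; ring.
  by split=> //; exists (B / C) => //; rewrite mulf_neq0 ?invr_neq0.
rewrite subr_eq0 (negPf AB) orbF => /eqP l0.
have AB2 : 2 * A = B.
  have : (A - B) * (2 * A - B) = 0.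
    move: c2 c1; rewrite l0 => c2 c1.
    (* The sum of the coefficients is the value at y = 1. *)
    transitivity ((A ^+ 2 - 2 * E * C)
     + (A * (A - B) - A * B - 0 * A ^+ 2 + 2 * E * D)
     + (- B * (A - B) - 0 * (A * (A - B) - A * B) + 2 * E * (C - D)));
      first by ring.
    by rewrite c1 c2 c3 subrr !addr0.
  by move/eqP; rewrite mulf_eq0 subr_eq0 (negPf AB) subr_eq0 => /eqP.
have A0 : A != 0 by apply: contra_neq B0 => A0; rewrite -AB2 A0 mulr0.
have E0 : E != 0.
  apply: contra_neq A0 => E0; move: c3; rewrite E0 !(mulr0, mul0r).
  by move/eqP; rewrite expf_eq0 /= => /eqP.
have C0 : C != 0.
  apply: contra_neq A0 => C0; move: c3; rewrite C0 !(mulr0, mul0r).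
  by move/eqP; rewrite expf_eq0 /= => /eqP.
have CD : D = 3 * C.
  have E2 : 2 * E != 0 by rewrite mulf_neq0.
  apply: (mulfI E2); apply/eqP; rewrite -subr_eq0; apply/eqP.
  transitivity (2 * A ^+ 2 - 2 * (2 * E * C) - 
    (- B * (A - B) - lambda * (A * (A - B) - A * B) + 2 * E * (C - D))).
    by rewrite l0 -AB2; ring.
  by rewrite c1 -c3; ring.
have : alpha 1 * C = 0.
  have := mobius 0%N; rewrite /y l0 CD -AB2.
  move=> e; transitivity (alpha 0 * (A * (0 + 2 + 0) - 2 * A)
    - alpha 1 * (C * (0 + 2 + 0) - 3 * C)); first by ring.
  by rewrite e subrr.
by move/eqP; rewrite mulf_eq0 (negPf (alpha_neq0 1)) (negPf C0).
Qed.

End Sequences.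

(** * The Gegenbauer generating functions *)

Section PowerComp.
Variable K : comUnitRingType.
Hypothesis unitS : forall n, n.+1%:R \is a @GRing.unit K.

Lemma fps_comp_power (a : K) H :
  fps_comp (fps_power (1 - 't) a) H = fps_power (1 - H) a.
Proof. by rewrite /fps_power !subKr fps_comp_varr. Qed.

Lemma fps_comp_ln (H : fps K) : fps_comp (fps_ln (1 - 't)) H = fps_ln (1 - H).
Proof. by rewrite /fps_ln !subKr fps_comp_varr. Qed.

Lemma fps_unitS n : n.+1%:R \is a @GRing.unit (fps K).
Proof. by rewrite -fps_const_nat fps_unitE; apply: unitS. Qed.

Lemma fps_natV n : (n.+1%:R : fps K)^-1 = (n.+1%:R^-1)%:S.
Proof.
apply: (mulrI (fps_unitS n)).
by rewrite divrr ?fps_unitS // -fps_const_nat -fps_constM divrr // fps_const1.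
Qed.
End PowerComp.

Section Existence.
Variable R : realType.
Local Notation C := R[i].
Local Notation unitC := (@complex_unitS R).
Local Notation unitP := (@poly_unitS R).

Lemma polyC_natV n : (n.+1%:R^-1)%:P = n.+1%:R^-1 :> {poly C}.
Proof. by rewrite rmorphV ?rmorph_nat //; apply: unitC. Qed.

Lemma fps_lift_natV n : fps_lift (n.+1%:R^-1) = n.+1%:R^-1 :> fps {poly C}.
Proof.
by rewrite (fps_natV unitC) (fps_natV unitP) fps_liftC polyC_natV.
Qed.

Lemma fps_coef_div (f : fps {poly C}) m n :
  (f / m.+1%:R) n = m.+1%:R^-1 *: f n.
Proof.
by rewrite (fps_natV unitP) mulrC fps_coefCM -polyC_natV mul_polyC.
Qed.

Definition gegenbauer_kernel : fps {poly C} := 1 - 'X%:S * 't + 't ^+ 2 / 4.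

Lemma gegenbauer_kernel0 : gegenbauer_kernel 0%N = 1.
Proof.
by rewrite fps_coefD fps_coefB fps_coefCM fps_coef_div fps_coefXn fps_coef1
  mulr0 scaler0 subr0 addr0.
Qed.

Lemma gegenbauer_kernel_unit : gegenbauer_kernel \is a GRing.unit.
Proof. exact: fps_unit1 gegenbauer_kernel0. Qed.

Lemma coef_gegenbauer_kernelM f n : (gegenbauer_kernel * f) n =
  f n - (if n is m.+1 then 'X * f m else 0)
  + (if n is m.+2 then 4^-1 *: f m else 0).
Proof.
have -> : gegenbauer_kernel * f = f - 'X%:S * ('t * f) + 't ^+ 2 * f / 4.
  by rewrite /gegenbauer_kernel; ring.
rewrite fps_coefD fps_coefB fps_coefCM fps_coefXM fps_coef_div fps_coefX2M.
by case: n => [|[|n]]; rewrite ?mulr0 ?scaler0.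
Qed.

Lemma deriv_gegenbauer_kernel : fps_deriv gegenbauer_kernel = 't / 2 - 'X%:S.
Proof.
rewrite fps_derivD fps_derivB fps_deriv1 sub0r fps_derivCM fps_deriv_var mulr1.
rewrite mulrC (fps_natV unitP) fps_derivCM -(fps_natV unitP) fps_deriv_varX2.
have u2 := fps_unitS unitP 1.
have -> : 4^-1 = 2^-1 * 2^-1 :> fps {poly C} by rewrite -invrM // -natrM.
rewrite addrC; congr (_ - _); rewrite mulrnAr -mulrnAl -mulrnAr -(mulr_natr 2^-1).
by rewrite mulVr // mulr1 mulrC.
Qed.

Lemma is_genfunI P (alpha : nat -> C) (A Q F : fps C) (A' Q' F' : fps {poly C}) :
  monic_poly_set P -> alpha 0 = 1 -> (forall n, alpha n != 0) ->
  F = Fps alpha -> A 0%N = 1 -> Q 0%N = 0 ->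
  fps_lift A = A' -> fps_lift Q = Q' -> fps_lift F = F' ->
  A' * fps_comp F' ('X%:S * 't * A' - Q') = weighted_series alpha P ->
  is_genfun P (GenFun alpha A Q F).
Proof. by move=> mP a0 an FE A0 Q0 <- <- <- GE; split. Qed.

Lemma quarter_t2_0 (K : comUnitRingType) (unitS : forall n, n.+1%:R \is a @GRing.unit K) :
  ('t ^+ 2 / 4 : fps K) 0%N = 0.
Proof. by rewrite (fps_natV unitS) mulrC fps_coefCM fps_coefXn mulr0. Qed.

Lemma fps_lift_quarter_t2 : fps_lift ('t ^+ 2 / 4) = 't ^+ 2 / 4 :> fps {poly C}.
Proof. by rewrite fps_liftM fps_liftX fps_lift_var fps_lift_natV. Qed.

Lemma lift_binomial (a : C) :
  fps_lift (fps_power (1 - 't) a) = fps_power (1 - 't) a%:P :> fps {poly C}.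
Proof.
have F0 : (1 - 't : fps C) 0%N = 1 by rewrite fps_coefB fps_coef1 subr0.
rewrite (fps_lift_power _ F0) fps_liftB fps_lift1 fps_lift_var.
reflexivity.
Qed.

Section FixedParameter.
Variable lambda : C.
Hypothesis lambda_neq : forall m, lambda + m.+1%:R != 0.
Hypothesis lambda_neq0 : lambda != 0.

Let lambda_neqn m : lambda + m%:R != 0.
Proof. by case: m => [|m]; rewrite ?addr0. Qed.

Definition gegenbauer_weight n : C := pochhammer lambda n / n`!%:R.
Local Notation w := gegenbauer_weight.

Lemma factC_neq0 n : n`!%:R != 0 :> C.
Proof. by rewrite pnatr_eq0 -lt0n fact_gt0. Qed.

Lemma gegenbauer_weightS n : n.+1%:R * w n.+1 = (n%:R + lambda) * w n.
Proof.
rewrite /gegenbauer_weight pochhammerS factS natrM.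
have f0 := factC_neq0 n; have n0 : n.+1%:R != 0 :> C by rewrite pnatr_eq0.
by field; rewrite f0 nat1r n0.
Qed.

Lemma gegenbauer_weight_omega n :
  (n%:R + 1 + lambda) * w n.+1 * gegenbauer_omega lambda n.+1
  = (n%:R + 2 * lambda) / 4 * w n.
Proof.
have n0 : n.+1%:R != 0 :> C by rewrite pnatr_eq0.
apply: (mulfI n0).
transitivity ((n%:R + 1 + lambda) * gegenbauer_omega lambda n.+1 * (n.+1%:R * w n.+1)).
  by ring.
rewrite gegenbauer_weightS; case: n {n0} => [|n].
  have l1 : 1 + lambda != 0 by rewrite addrC; apply: (lambda_neq 0).
  by rewrite /gegenbauer_omega /=; field; nonzero.
rewrite gegenbauer_omegaSS -(natr1 n.+1) -(natr1 n).
have l1 := lambda_neq1 lambda_neq n; have l2 := lambda_neq2 lambda_neq n.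
by field; nonzero.
Qed.

Lemma gegenbauer_weighted_rec n :
  n.+2%:R *: (w n.+2 *: gegenbauer lambda n.+2)
  = (n%:R + 1 + lambda) *: ('X * (w n.+1 *: gegenbauer lambda n.+1))
    - ((n%:R + 2 * lambda) / 4) *: (w n *: gegenbauer lambda n).
Proof.
rewrite scalerA gegenbauer_weightS -natr1 gegenbauerS scalerBr -scalerAr !scalerA.
by rewrite gegenbauer_weight_omega.
Qed.

(** The recurrence above is the coefficientwise form of D y' = - lambda D' y,
    D = 1 - xt + t^2/4. *)
Lemma sum_weighted_gegenbauer :
  weighted_series w (gegenbauer lambda) = fps_power gegenbauer_kernel (- lambda)%:P.
Proof.
have w0 : w 0 = 1 by rewrite /gegenbauer_weight /pochhammer big_ord0 fact0 divr1.
apply: (fps_powerP unitP); first exact: gegenbauer_kernel0.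
  by rewrite /= w0 scale1r gegenbauer0.
set W := weighted_series _ _; rewrite deriv_gegenbauer_kernel.
have WE n : W n = w n *: gegenbauer lambda n by [].
have dWE n : fps_deriv W n = n.+1%:R *: W n.+1 by rewrite /= scaler_nat.
apply: fps_ext => n; rewrite coef_gegenbauer_kernelM -mulrA fps_coefCM mulrBl fps_coefB.
rewrite mulrAC fps_coef_div fps_coefCM fps_coefXM !dWE.
case: n => [|[|n]].
- have := gegenbauer_weightS 0; rewrite w0 mul1r add0r mulr1 => w1.
  rewrite subr0 addr0 scaler0 scale1r !WE w1 gegenbauer1 w0 scale1r.
  by rewrite gegenbauer0 mulr1 sub0r polyCN mulNr mulrN opprK mul_polyC.
- rewrite addr0 WE gegenbauer_weighted_rec -!WE dWE scale1r !add0r.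
  rewrite [W 0%N]WE w0 gegenbauer0 !scale1r.
  rewrite polyCN mulNr mulrBr mul_polyC -opprB -!mul_polyC.
  rewrite (_ : (2 * lambda / 4) = lambda * 2^-1); last by field.
  by rewrite polyCD polyCM; ring.
rewrite WE gegenbauer_weighted_rec -!WE !dWE -(natr1 n.+1) -(natr1 n).
rewrite -!mul_polyC !(polyCD, polyCM, polyCN, polyC1).
have -> : (4^-1)%:P = (2^-1)%:P * (2^-1)%:P :> {poly C}.
  by rewrite -polyCM; congr (_%:P); field.
have e2 : 2 * (2^-1)%:P = 1 :> {poly C}.
  by rewrite -[2]polyC_natr -polyCM divff ?pnatr_eq0.
move: (W _) (W _) (2^-1)%:P (n%:R)%:P e2 => W2 W1 h N e2.
apply/eqP; rewrite -subr_eq0; apply/eqP.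
transitivity (lambda%:P * h * W2 * (1 - 2 * h)); first by ring.
by rewrite e2 subrr mulr0.
Qed.

Lemma genfun_C1 : is_genfun (gegenbauer lambda) (gf_C1 lambda).
Proof.
apply: (is_genfunI _ _ _ _ _ _ (fps_lift1 R) fps_lift_quarter_t2 (lift_binomial _)).
- exact: gegenbauer_monic.
- by rewrite /pochhammer big_ord0 fact0 divr1.
- move=> n; rewrite mulf_neq0 ?invr_neq0 ?factC_neq0 //.
  by apply/prodf_neq0 => i _; apply: lambda_neqn.
- rewrite /fps_power subKr fps_comp_varr; congr Fps.
  by apply/boolp.funext => n; rewrite opprK.
- by [].
- exact: (quarter_t2_0 unitC).
rewrite fps_comp_power mul1r mulr1 opprB addrA addrAC -/gegenbauer_kernel.
exact/esym/sum_weighted_gegenbauer.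
Qed.

Lemma deriv_gegenbauer_kernel_t :
  gegenbauer_kernel - 't * fps_deriv gegenbauer_kernel = 1 - 't ^+ 2 / 4.
Proof.
have u2 := fps_unitS unitP 1.
rewrite deriv_gegenbauer_kernel /gegenbauer_kernel.
have -> : 4^-1 = 2^-1 * 2^-1 :> fps {poly C} by rewrite -invrM // -natrM.
have := divrr u2; move: 2^-1 => h e.
apply/eqP; rewrite -subr_eq0; apply/eqP.
transitivity ('t ^+ 2 * h * (2 * h - 1)); first by ring.
by rewrite e subrr mulr0.
Qed.

(** Since (lambda + 1)_n / n! = (1 + n / lambda) (lambda)_n / n!, this series is
    W + t W' / lambda, where W is the sum of [sum_weighted_gegenbauer], whose
    logarithmic derivative is - lambda D'/D. *)
Lemma sum_weighted_gegenbauer2 :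
  weighted_series (fun n => pochhammer (lambda + 1) n / n`!%:R)
    (gegenbauer lambda)
  = (1 - 't ^+ 2 / 4) * fps_power gegenbauer_kernel (- lambda - 1)%:P.
Proof.
set b := (- lambda - 1)%:P; set W := weighted_series w (gegenbauer lambda).
have lu : lambda%:P%:S \is a @GRing.unit (fps {poly C}).
  by rewrite fps_unitE /= rmorph_unit // unitfE.
have WE : W = fps_power gegenbauer_kernel b * gegenbauer_kernel.
  rewrite -[X in _ * X](fps_power_id unitP gegenbauer_kernel0) -(fps_powerD unitP _ _ gegenbauer_kernel0).
  rewrite [LHS]sum_weighted_gegenbauer; congr fps_power.
  by rewrite /b -polyC1 -polyCD subrK.
have dW : gegenbauer_kernel * fps_deriv W = - (lambda%:P%:S * fps_deriv gegenbauer_kernel * W).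
  rewrite /W sum_weighted_gegenbauer (fps_power_ode unitP) ?gegenbauer_kernel0 //.
  by rewrite polyCN fps_constN !mulNr.
have W2E : lambda%:P%:S * weighted_series
   (fun n => pochhammer (lambda + 1) n / n`!%:R) (gegenbauer lambda)
   = lambda%:P%:S * W + 't * fps_deriv W.
  apply: fps_ext => n; rewrite fps_coefD !fps_coefCM fps_coefXM.
  rewrite /= !mul_polyC !scalerA.
  have -> : lambda * (pochhammer (lambda + 1) n / n`!%:R) = (lambda + n%:R) * w n.
    by rewrite /w !mulrA -pochhammerSl pochhammerSr [_ * (_ + _)]mulrC.
  rewrite mulrDl scalerDl; congr (_ + _); case: n => [|n].
    by rewrite mul0r scale0r.
  by rewrite -scalerA scaler_nat.
apply: (mulrI lu); rewrite W2E; apply: (mulrI gegenbauer_kernel_unit).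
rewrite -deriv_gegenbauer_kernel_t mulrDr [gegenbauer_kernel * ('t * _)]mulrCA dW WE.
move: gegenbauer_kernel (lambda%:P)%:S (fps_deriv gegenbauer_kernel) (fps_power gegenbauer_kernel b) => k l k' p.
by ring.
Qed.

(** Here 1 - (xtA - R) = A D, so that A F(xtA - R) = A (A D)^(-lambda - 1)
    = A^(-lambda) D^(-lambda - 1), and A^(-lambda) = 1 - t^2/4 by the choice of
    A. *)
Lemma genfun_C2 : is_genfun (gegenbauer lambda) (gf_C2 lambda).
Proof.
have E0 : (1 - 't ^+ 2 / 4 : fps C) 0%N = 1.
  by rewrite fps_coefB fps_coef1 (quarter_t2_0 unitC) subr0.
have E0' : (1 - 't ^+ 2 / 4 : fps {poly C}) 0%N = 1.
  by rewrite fps_coefB fps_coef1 (quarter_t2_0 unitP) subr0.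
set A := fps_power (1 - 't ^+ 2 / 4 : fps {poly C}) (- lambda^-1)%:P.
have lA : fps_lift (fps_power (1 - 't ^+ 2 / 4) (- lambda^-1)) = A.
  by rewrite (fps_lift_power _ E0) fps_liftB fps_lift1 fps_lift_quarter_t2.
have lR : fps_lift ((1 + 't ^+ 2 / 4) * fps_power (1 - 't ^+ 2 / 4) (- lambda^-1) - 1)
    = (1 + 't ^+ 2 / 4) * A - 1.
  by rewrite fps_liftB fps_liftM fps_liftD fps_lift1 fps_lift_quarter_t2 lA.
apply: (is_genfunI _ _ _ _ _ _ lA lR (lift_binomial _)).
- exact: gegenbauer_monic.
- by rewrite /pochhammer big_ord0 fact0 divr1.
- move=> n; rewrite mulf_neq0 ?invr_neq0 ?factC_neq0 //.
  by apply/prodf_neq0 => i _; rewrite -addrA nat1r.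
- rewrite /fps_power subKr fps_comp_varr; congr Fps.
  by apply/boolp.funext => n; rewrite opprB opprK addrC.
- exact: fps_power0.
- rewrite fps_coefB fps_coefM0 fps_power0 mulr1 fps_coefD fps_coef1.
  by rewrite (quarter_t2_0 unitC) addr0 subrr.
rewrite fps_comp_power [RHS]sum_weighted_gegenbauer2.
have A0 : A 0%N = 1 by exact: fps_power0.
have -> : 1 - ('X%:S * 't * A - ((1 + 't ^+ 2 / 4) * A - 1)) = A * gegenbauer_kernel.
  by rewrite /gegenbauer_kernel; ring.
rewrite (fps_powerM unitP _ A0 gegenbauer_kernel0) (fps_power_power unitP _ _ E0') mulrA.
congr (_ * _); rewrite -(fps_powerD unitP _ _ E0') -polyCM -polyCD.
have -> : - lambda^-1 + - lambda^-1 * (- lambda - 1) = 1 by field.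
exact: (fps_power_id unitP E0').
Qed.

End FixedParameter.
End Existence.

Arguments gegenbauer_kernel {R}.

(** * The Chebyshev generating functions *)

(** The roots of the characteristic polynomial of the products are the products of
    the roots for the factors; the recurrence of order four so obtained, times 4,
    is [product_kernel] below.  It holds from n = 3
    on, not only from n = 4, because u 1 = x u 0 amounts to u (-1) = 0. *)
Lemma product_recurrence (S : comNzRingType) (a u w : nat -> S) (r x k : S) :
  4 * k = 1 -> a 0 = 1 -> u 0 = 1 -> u 1 = x ->
  (forall n, a n.+2 = 2 * r * a n.+1 - a n) ->
  (forall n, u n.+2 = x * u n.+1 - k * u n) ->
  (forall n, w n = a n * u n) ->
  forall n, 4 * w n - (if n is m.+1 then 8 * r * x * w m else 0)
  + (if n is m.+2 then (4 * r ^+ 2 + 4 * x ^+ 2 - 2) * w m else 0)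
  - (if n is m.+3 then 2 * r * x * w m else 0)
  + (if n is m.+4 then k * w m else 0)
  = (if n is 0%N then 4 else 0) + 4 * (a 1 - 2 * r) * x * (n == 1%N)%:R
    - (1 + 2 * (a 1 - 2 * r) * r) * (n == 2%N)%:R.
Proof.
move=> k4 a0 u0 u1 aSS uSS wE; have e : 4 * k - 1 = 0 by rewrite k4 subrr.
case=> [|[|[|[|n]]]] /=; rewrite !wE ?uSS ?aSS ?u1 ?u0 ?a0.
- by ring.
- by ring.
- apply/eqP; rewrite -subr_eq0; apply/eqP.
  by transitivity ((4 * k - 1) * (1 - 2 * r * a 1)); [ring | rewrite e mul0r].
- apply/eqP; rewrite -subr_eq0; apply/eqP.
  transitivity ((4 * k - 1) * (2 * r * x - (4 * r ^+ 2 - 2) * (a 1 * x))).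
    by ring.
  by rewrite e mul0r.
- apply/eqP; rewrite -subr_eq0; apply/eqP.
  transitivity ((4 * k - 1) *
    (2 * r * x * (a n.+1 * u n.+1) - k * (a n * u n)
     - (4 * r ^+ 2 - 2) * ((2 * r * a n.+1 - a n) * (x * u n.+1 - k * u n)))).
    by ring.
  by rewrite e mul0r.
Qed.

Section Chebyshev.
Variable R : realType.
Local Notation C := R[i].
Local Notation unitC := (@complex_unitS R).
Local Notation unitP := (@poly_unitS R).
Local Notation T := (@chebyshevT R).
Local Notation U := (@chebyshevU R).

Lemma natC_neq0 n : n.+1%:R != 0 :> C.
Proof. by rewrite pnatr_eq0. Qed.

Lemma chebyshevU_SS n : U n.+2 = 'X * U n.+1 - 4^-1 *: U n.
Proof.
rewrite /chebyshevU gegenbauerS; congr (_ - _ *: _).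
rewrite /gegenbauer_omega; case: n => [|n] /=; first by congr (_^-1); ring.
have n1 := natC_neq0 n; have n2 := natC_neq0 n.+1; have n3 := natC_neq0 n.+2.
rewrite -(natr1 n.+1) -(natr1 n) -(natr1 n.+2) -(natr1 n.+1) -(natr1 n) in n1 n2 n3 *.
by field; nonzero.
Qed.

Lemma chebyshevU_0 : U 0 = 1.
Proof. exact: gegenbauer0. Qed.

Lemma chebyshevU_1 : U 1 = 'X.
Proof. exact: gegenbauer1. Qed.

Lemma quarterC : 4^-1 = 2^-1 * 2^-1 :> C.
Proof. by rewrite -invfM -natrM. Qed.

Lemma twoC_half : 2%:P * (2^-1)%:P = 1 :> {poly C}.
Proof. by rewrite -polyCM divff ?pnatr_eq0. Qed.

Lemma chebyshevT_2 : T 2 = 'X * T 1 - 2^-1 *: T 0.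
Proof. by rewrite /chebyshevT gegenbauerS /gegenbauer_omega /= addr0 mulr1. Qed.

Lemma chebyshevT_SSS n : T n.+3 = 'X * T n.+2 - 4^-1 *: T n.+1.
Proof.
rewrite /chebyshevT gegenbauerS; congr (_ - _ *: _).
rewrite /gegenbauer_omega /=.
have n1 := natC_neq0 n; have n2 := natC_neq0 n.+1.
rewrite -(natr1 n.+1) -(natr1 n) in n1 n2 *.
by field; nonzero.
Qed.

Lemma sum_chebyshevT :
  weighted_series (fun n => if n is 0%N then 0 else n%:R^-1) T = - fps_ln gegenbauer_kernel.
Proof.
set V := weighted_series _ _.
have dV n : fps_deriv V n = T n.+1.
  by rewrite /= -scaler_nat scalerA divff ?scale1r // natC_neq0.
apply: (fps_deriv_inj unitP); last first.
  by rewrite fps_coefN fps_comp0 /= scale0r oppr0.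
rewrite fps_derivN; apply: (mulrI (gegenbauer_kernel_unit R)).
rewrite mulrN (fps_ln_ode unitP) ?gegenbauer_kernel0 // deriv_gegenbauer_kernel opprB.
apply: fps_ext => n; rewrite coef_gegenbauer_kernelM fps_coefB fps_coef_div.
case: n => [|[|n]]; rewrite !dV /=.
- by rewrite /chebyshevT gegenbauer1 subr0 addr0 scaler0 subr0.
- have T0 : T 0 = 1 by exact: gegenbauer0.
  by rewrite chebyshevT_2 T0 addr0 sub0r addrAC subrr sub0r.
- rewrite chebyshevT_SSS scaler0 subr0; move: (T _) (T _) => p q; ring.
Qed.

Lemma lift_ln : fps_lift (1 - fps_ln (1 - 't)) = 1 - fps_ln (1 - 't) :> fps {poly C}.
Proof.
rewrite fps_liftB fps_lift1 /fps_ln !subKr !fps_comp_varr; congr (_ - _).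
by apply: fps_ext => -[|n]; rewrite /= ?polyCN ?polyC_natV.
Qed.

Lemma genfun_T : is_genfun T (gf_T R).
Proof.
apply: (is_genfunI _ _ _ _ _ _ (fps_lift1 R) (fps_lift_quarter_t2 R) lift_ln).
- exact: gegenbauer_monic.
- by [].
- by case=> [|n]; rewrite ?oner_neq0 // invr_neq0 // natC_neq0.
- rewrite /fps_ln subKr fps_comp_varr; apply: fps_ext => -[|n].
    by rewrite fps_coefB fps_coef1 subr0.
  by rewrite fps_coefB fps_coef1 sub0r opprK.
- by [].
- exact: (quarter_t2_0 unitC).
rewrite fps_compB fps_comp_one fps_comp_ln !mul1r mulr1 opprB addrA addrAC.
rewrite -/gegenbauer_kernel -sum_chebyshevT; apply: fps_ext => -[|n].
  by rewrite fps_coefD /= scale0r addr0 scale1r.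
by rewrite fps_coefD fps_coef1 add0r.
Qed.

Lemma sum_chebyshevU : gegenbauer_kernel * weighted_series (fun=> 1) U = 1.
Proof.
apply: fps_ext => n; rewrite coef_gegenbauer_kernelM fps_coef1.
case: n => [|[|n]] /=; rewrite !scale1r.
- by rewrite subr0 addr0 /chebyshevU gegenbauer0.
- by rewrite [U 0]gegenbauer0 [U 1]gegenbauer1 mulr1 subrr addr0.
- by rewrite chebyshevU_SS; move: (U _) (U _) => p q; ring.
Qed.

Lemma sum_geometric (K : comUnitRingType) : (1 - 't) * Fps (fun=> 1) = 1 :> fps K.
Proof.
apply: fps_ext => n; rewrite mulrBl mul1r fps_coefB fps_coefXM fps_coef1.
by case: n => [|n]; rewrite ?subr0 ?subrr.
Qed.

(** For geometric weights A cancels: A / (1 - (xtA - R)) = A / (A D) = 1 / D. *)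
Lemma genfun_U1 (A : fps C) : A 0%N = 1 -> is_genfun U (gf_U1 A).
Proof.
move=> A0; have u1 : (1 - 't : fps C) \is a GRing.unit.
  by rewrite fps_unit1 // fps_coefB fps_coef1 subr0.
have FE : 1 / (1 - 't) = Fps (fun=> 1) :> fps C.
  by apply: (mulrI u1); rewrite sum_geometric div1r divrr.
have lQ : fps_lift ((1 + 't ^+ 2 / 4) * A - 1)
    = (1 + 't ^+ 2 / 4) * fps_lift A - 1.
  by rewrite fps_liftB fps_liftM fps_liftD fps_lift1 fps_lift_quarter_t2.
apply: (is_genfunI _ _ _ _ _ _ erefl lQ erefl).
- exact: gegenbauer_monic.
- by [].
- by move=> n; exact: oner_neq0.
- exact: FE.
- exact: A0.
- rewrite fps_coefB fps_coefM0 A0 mulr1 fps_coefD fps_coef1.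
  by rewrite (quarter_t2_0 unitC) addr0 subrr.
rewrite FE; set H := 'X%:S * _ * _ - _.
have HE : 1 - H = fps_lift A * gegenbauer_kernel by rewrite /H /gegenbauer_kernel; ring.
have H0 : H 0%N = 0.
  rewrite -[H](subKr 1) HE fps_coefB fps_coefM0 gegenbauer_kernel0 mulr1 fps_coef1 /= A0.
  by rewrite subrr.
have : fps_comp (fps_lift ((1 - 't) * Fps (fun=> 1))) H = 1.
  by rewrite sum_geometric fps_lift1 fps_comp_one.
rewrite fps_liftM fps_liftB fps_lift1 fps_lift_var mulrBl mul1r fps_compB fps_compXM //.
move: (fps_comp _ _) => G GE; apply: (mulrI (gegenbauer_kernel_unit R)).
rewrite [RHS]sum_chebyshevU -GE -[X in _ = X - _]mul1r -mulrBl HE.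
by rewrite mulrCA mulrA.
Qed.

(* Keeps unification from computing these polynomials when it compares indices. *)
Local Opaque gegenbauer.

Section Rational.
Variables rho alpha1 : C.

Definition chebyshevU_kernel : fps {poly C} :=
  1 - 2 * rho%:P%:S * 'X%:S * 't + (rho ^+ 2)%:P%:S * 't ^+ 2.

Lemma chebyshevU_kernel_unit : chebyshevU_kernel \is a GRing.unit.
Proof.
apply: fps_unit1; rewrite /chebyshevU_kernel mulrC fps_coefD fps_coefB fps_coefXM.
by rewrite fps_coefCM fps_coefXn mulr0 addr0 subr0.
Qed.

Lemma coef_chebyshevU_kernelM f n : (chebyshevU_kernel * f) n =
  f n - (if n is m.+1 then (2 * rho) *: ('X * f m) else 0)
  + (if n is m.+2 then rho ^+ 2 *: f m else 0).
Proof.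
have -> : chebyshevU_kernel * f = f - (2 * rho)%:P%:S * ('X%:S * ('t * f))
    + (rho ^+ 2)%:P%:S * ('t ^+ 2 * f).
  by rewrite /chebyshevU_kernel (polyCM 2) (polyC_natr _ 2) fps_constM fps_const_nat; ring.
rewrite fps_coefD fps_coefB !fps_coefCM fps_coefXM fps_coefX2M !mul_polyC.
by case: n => [|[|n]]; rewrite ?mulr0 ?scaler0.
Qed.

Lemma sum_chebyshevU2 :
  let W := 1 + alpha1%:P%:S * weighted_series
            (fun n => if n is m.+1 then 2 ^+ m * rho ^+ m else 0) U in
  chebyshevU_kernel * W = 1 + (alpha1 - 2 * rho)%:P%:S
           * ('X%:S * 't - (rho / 2)%:P%:S * 't ^+ 2).
Proof.
move=> W.
have W0 : W 0%N = 1 by rewrite fps_coefD fps_coefCM /= scale0r mulr0 addr0.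
have WS m : W m.+1 = (alpha1 * (2 ^+ m * rho ^+ m)) *: U m.+1.
  by rewrite fps_coefD fps_coefCM /= add0r mul_polyC scalerA.
move: W W0 WS => W W0 WS; apply: fps_ext => n; rewrite coef_chebyshevU_kernelM.
rewrite fps_coefD fps_coef1 fps_coefCM fps_coefB !fps_coefCM fps_coefXn.
case: n => [|[|[|n]]]; rewrite ?fps_coefXn ?WS ?W0 /=.
- by rewrite subr0 addr0 !mulr0 subr0 mulr0 addr0.
- rewrite chebyshevU_1 !expr0 !mulr1 mulr0 subr0 addr0 add0r mul_polyC.
  by rewrite -scalerBl.
- rewrite chebyshevU_SS chebyshevU_1 chebyshevU_0 !expr0 !expr1 expr2 quarterC.
  rewrite -!mul_polyC !(polyCB, polyCM, polyC1).
  move: twoC_half; move: 2%:P (2^-1)%:P rho%:P alpha1%:P => t h r a e.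
  apply/eqP; rewrite -subr_eq0; apply/eqP.
  transitivity (- r * (r + a * h) * (t * h - 1)); first by ring.
  by rewrite e subrr mulr0.
rewrite chebyshevU_SS quarterC !mulr0 subrr mulr0 addr0 !exprS.
move: (2 ^+ n) (rho ^+ n) (U n.+2) (U n.+1) => tn rn p q.
rewrite -!mul_polyC expr0 !(polyCB, polyCM, polyC1).
move: twoC_half; move: 2%:P (2^-1)%:P rho%:P alpha1%:P tn%:P rn%:P => t h r a tm rm e.
apply/eqP; rewrite -subr_eq0; apply/eqP.
transitivity (- a * tm * rm * r * r * q * (t * h + 1) * (t * h - 1)); first by ring.
by rewrite e subrr mulr0.
Qed.

Lemma genfun_U2 : rho != 0 -> alpha1 != 0 -> is_genfun U (gf_U2 rho alpha1).
Proof.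
move=> r0 a0; set alpha := gf_alpha (gf_U2 rho alpha1).
set D := 1 - (2 * rho)%:S * 't : fps C; set N := 1 + (alpha1 - 2 * rho)%:S * 't : fps C.
have D1 : D 0%N = 1 by rewrite fps_coefB fps_coef1 fps_coefCM mulr0 subr0.
have DF : D * Fps alpha = N.
  rewrite /D mulrBl mul1r -mulrA; apply: fps_ext => n.
  rewrite fps_coefB fps_coefD !fps_coefCM fps_coefXM fps_coef1.
  case: n => [|[|n]]; rewrite /alpha /=; first by rewrite !mulr0 subr0 addr0.
    by rewrite !expr0 !mulr1 add0r.
  by rewrite mulr0 addr0 !exprS; move: (2 ^+ n) (rho ^+ n) => *; ring.
have FE : N / D = Fps alpha by rewrite -DF mulrC mulKr ?fps_unit1.
have lQ : fps_lift (rho%:S * 't ^+ 2 / 2) = rho%:P%:S * 't ^+ 2 / 2.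
  by rewrite fps_liftM fps_lift_natV (fps_liftM rho%:S) fps_liftX fps_lift_var fps_liftC.
apply: (is_genfunI _ _ _ _ _ _ (fps_lift1 R) lQ erefl).
- exact: gegenbauer_monic.
- by [].
- case=> [|n]; rewrite /alpha ?oner_neq0 //=.
  by rewrite !mulf_neq0 ?expf_neq0 // pnatr_eq0.
- exact: FE.
- by [].
- by rewrite (fps_natV unitC) mulrC fps_coefCM fps_coefCM fps_coefXn !mulr0.
rewrite mul1r mulr1 FE; set H := _ - _.
have H0 : H 0%N = 0.
  rewrite fps_coefB mulrC fps_coefXM (fps_natV unitP) mulrC fps_coefCM fps_coefCM.
  by rewrite fps_coefXn !mulr0 subr0.
have := congr1 (fun f => fps_comp (fps_lift f) H) DF.
rewrite /D /N fps_liftM fps_liftB fps_liftD fps_lift1 !fps_liftM !fps_liftC fps_lift_var.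
rewrite mulrBl mul1r -mulrA fps_compB fps_compCM fps_compXM //.
rewrite fps_compD fps_comp_one fps_compCM fps_comp_var //.
have wE : weighted_series alpha U = 1 + alpha1%:P%:S * weighted_series
            (fun n => if n is m.+1 then 2 ^+ m * rho ^+ m else 0) U.
  apply: fps_ext => -[|n]; rewrite fps_coefD fps_coefCM.
    by rewrite /= scale0r mulr0 addr0 scale1r chebyshevU_0.
  by rewrite /= add0r mul_polyC scalerA mulrA.
move: (fps_comp _ H) => G GE; apply: (mulrI chebyshevU_kernel_unit).
have HE : H = 'X%:S * 't - (rho / 2)%:P%:S * 't ^+ 2.
  rewrite /H polyCM polyC_natV fps_constM -(fps_natV unitP).
  by congr (_ - _); rewrite mulrAC.
rewrite [in RHS]wE sum_chebyshevU2 -HE -GE.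
have -> : chebyshevU_kernel = 1 - (2 * rho)%:P%:S * H.
  rewrite /chebyshevU_kernel (polyCM 2) (polyC_natr _ 2) fps_constM fps_const_nat /H.
  have := divrr (fps_unitS unitP 1); rewrite polyCM fps_constM.
  move: 2^-1 rho%:P%:S => h r e; apply/eqP; rewrite -subr_eq0; apply/eqP.
  transitivity (r ^+ 2 * 't ^+ 2 * (1 - 2 * h)); first by ring.
  by rewrite e subrr mulr0.
by ring.
Qed.

Local Notation aU := (alpha_U3 rho alpha1).

Lemma alpha_U3_0 : aU 0 = 1.
Proof. by []. Qed.

Lemma alpha_U3S n :
  aU n.+1 = 2 ^+ n.+1 * ((U n.+1).[rho] + (alpha1 / 2 - rho) * (U n).[rho]).
Proof. by []. Qed.

Local Opaque alpha_U3.

Lemma alpha_U3_1 : aU 1 = alpha1.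
Proof.
rewrite alpha_U3S chebyshevU_1 chebyshevU_0 hornerX hornerC expr1 mulr1.
by rewrite addrC subrK mulrC divfK ?pnatr_eq0.
Qed.

Lemma alpha_U3_SS n : aU n.+2 = 2 * rho * aU n.+1 - aU n.
Proof.
have US m : (U m.+2).[rho] = rho * (U m.+1).[rho] - 4^-1 * (U m).[rho].
  by rewrite chebyshevU_SS !hornerE.
case: n => [|n].
  have H u2 u1 u0 a1 a0 : u2 = rho * u1 - 4^-1 * u0 -> u1 = rho -> u0 = 1 ->
      a1 = alpha1 -> a0 = 1 ->
      2 ^+ 2 * (u2 + (alpha1 / 2 - rho) * u1) = 2 * rho * a1 - a0.
    by move=> -> -> -> -> ->; field.
  rewrite [LHS]alpha_U3S; apply: (H _ _ _ _ _ (US 0%N)).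
  - by rewrite chebyshevU_1 hornerX.
  - by rewrite chebyshevU_0 hornerC.
  - exact: alpha_U3_1.
  - exact: alpha_U3_0.
have H q3 q2 q1 u3 u2 u1 u0 (c := alpha1 / 2 - rho) : q3 = 2 * q2 -> q2 = 2 * q1 ->
    u3 = rho * u2 - 4^-1 * u1 -> u2 = rho * u1 - 4^-1 * u0 ->
    q3 * (u3 + c * u2) = 2 * rho * (q2 * (u2 + c * u1)) - q1 * (u1 + c * u0).
  by move=> -> -> -> ->; rewrite /c; field.
rewrite [LHS]alpha_U3S [aU n.+2]alpha_U3S [aU n.+1]alpha_U3S.
exact: (H _ _ _ _ _ _ _ (exprS _ _) (exprS _ _) (US n.+1) (US n)).
Qed.

Definition product_kernel : fps {poly C} :=
  4 - 8 * rho%:P%:S * 'X%:S * 't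
  + (4 * rho%:P ^+ 2 + 4 * 'X ^+ 2 - 2)%:S * 't ^+ 2
  - 2 * rho%:P%:S * 'X%:S * 't ^+ 3 + 't ^+ 4 / 4.

Lemma coef_product_kernelM f n : (product_kernel * f) n =
  4 * f n - (if n is m.+1 then 8 * rho%:P * 'X * f m else 0)
  + (if n is m.+2 then (4 * rho%:P ^+ 2 + 4 * 'X ^+ 2 - 2) * f m else 0)
  - (if n is m.+3 then 2 * rho%:P * 'X * f m else 0)
  + (if n is m.+4 then (4^-1)%:P * f m else 0).
Proof.
set c := 4 * _ + _ - _.
have -> : product_kernel * f = 4%:S * f - (8 * rho%:P * 'X)%:S * ('t * f)
   + c%:S * ('t ^+ 2 * f) - (2 * rho%:P * 'X)%:S * ('t ^+ 2 * ('t * f))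
   + (4^-1)%:P%:S * ('t ^+ 2 * ('t ^+ 2 * f)).
  rewrite /product_kernel -/c polyC_natV -(fps_natV unitP).
  rewrite !fps_constM (fps_const_nat _ 8) (fps_const_nat _ 2) (fps_const_nat _ 4).
  by move: c%:S => d; ring.
rewrite fps_coefD fps_coefB fps_coefD fps_coefB !fps_coefCM fps_coefXM !fps_coefX2M.
by case: n => [|[|[|[|n]]]]; rewrite ?fps_coefXM ?fps_coefX2M ?mulr0.
Qed.

Lemma product_kernel_unit : product_kernel \is a GRing.unit.
Proof.
rewrite fps_unitE; have := coef_product_kernelM 1 0.
by rewrite mulr1 fps_coef1 mulr1 !subr0 !addr0 => ->; apply: (unitP 3).
Qed.

Lemma sum_chebyshevU3 : product_kernel * weighted_series aU U
  = 4 - 't ^+ 2 + 2 * (alpha1 - 2 * rho)%:P%:S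
      * (2 * 'X%:S * 't - rho%:P%:S * 't ^+ 2).
Proof.
set W := weighted_series aU U.
have WE n : W n = (aU n)%:P * U n by rewrite mul_polyC.
have W0 : W 0%N = 1 by rewrite WE chebyshevU_0 mulr1.
have aSS n : (aU n.+2)%:P = 2 * rho%:P * (aU n.+1)%:P - (aU n)%:P.
  by rewrite alpha_U3_SS polyCB !polyCM polyC_natr.
have USS n : U n.+2 = 'X * U n.+1 - (4^-1)%:P * U n.
  by rewrite chebyshevU_SS mul_polyC.
have e : 4 * (4^-1)%:P = 1 :> {poly C}.
  by rewrite -(polyC_natr _ 4) -polyCM divff ?pnatr_eq0.
have rhsE : 4 - 't ^+ 2 + 2 * (alpha1 - 2 * rho)%:P%:S
      * (2 * 'X%:S * 't - rho%:P%:S * 't ^+ 2)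
  = 4 + (4 * (alpha1%:P - 2 * rho%:P) * 'X)%:S * 't
    - (1 + 2 * (alpha1%:P - 2 * rho%:P) * rho%:P)%:S * 't ^+ 2 :> fps {poly C}.
  rewrite polyCB (polyCM 2) (polyC_natr _ 2).
  rewrite (fps_constD 1) fps_const1 (fps_constM _ rho%:P) (fps_constM _ 'X).
  rewrite (fps_constM 2) (fps_constM 4) fps_constB (fps_constM 2).
  by rewrite (fps_const_nat _ 2) (fps_const_nat _ 4); ring.
rewrite rhsE -[X in X + _ - _](fps_const_nat _ 4).
apply: fps_ext => n; rewrite coef_product_kernelM.
rewrite fps_coefB fps_coefD fps_coefC !fps_coefCM fps_coefXn.
have a0 : (aU 0)%:P = 1 by rewrite alpha_U3_0.
have := product_recurrence e a0 chebyshevU_0 chebyshevU_1 aSS USS WE n.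
by rewrite alpha_U3_1.
Qed.

Lemma four_sub_t2_0 (S : comNzRingType) : (4 - 't ^+ 2 : fps S) 0%N = 4.
Proof. by rewrite fps_coefB fps_coefXn -(fps_const_nat _ 4) subr0. Qed.

Lemma fps_lift_div (f g : fps C) : g \is a GRing.unit ->
  fps_lift (f / g) = fps_lift f / fps_lift g.
Proof.
move=> ug; have ug' : fps_lift g \is a GRing.unit.
  by rewrite fps_unitE /= rmorph_unit.
by apply: (mulIr ug'); rewrite divrK // -fps_liftM divrK.
Qed.

(** With B = 4 - t^2 and H = xtA - R the product B H is a polynomial, and the
    denominator of F(H) times B^2 is four times the asserted one. *)
Lemma genfun_U3 : (forall n, aU n != 0) -> is_genfun U (gf_U3 rho alpha1).
Proof.
move=> an; set D := 1 - (2 * rho)%:S * 't + 't ^+ 2 : fps C.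
set N := 1 + (alpha1 - 2 * rho)%:S * 't : fps C.
have D1 : D 0%N = 1.
  by rewrite fps_coefD fps_coefB fps_coef1 fps_coefCM fps_coefXn mulr0 subr0 addr0.
have DF : D * Fps aU = N.
  rewrite /D mulrDl mulrBl mul1r -mulrA; apply: fps_ext => n.
  rewrite fps_coefD fps_coefB fps_coefD !fps_coefCM fps_coefXM fps_coefX2M fps_coef1.
  case: n => [|[|n]] /=; first by rewrite alpha_U3_0 !mulr0 subr0 !addr0.
    by rewrite alpha_U3_0 alpha_U3_1 !mulr1 addr0 add0r.
  by rewrite alpha_U3_SS mulr0 addr0; ring.
have FE : N / D = Fps aU by rewrite -DF mulrC mulKr ?fps_unit1.
pose B : fps C := 4 - 't ^+ 2; pose B' : fps {poly C} := 4 - 't ^+ 2.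
have uB : B \is a GRing.unit.
  by rewrite fps_unitE four_sub_t2_0; apply: (unitC 3).
have uB' : B' \is a GRing.unit.
  by rewrite fps_unitE four_sub_t2_0; apply: (unitP 3).
have lB : fps_lift B = B' by rewrite fps_liftB fps_lift_nat fps_liftX fps_lift_var.
have lA : fps_lift (4 / B) = 4 / B' by rewrite fps_lift_div // lB fps_lift_nat.
have lQ : fps_lift (2 * rho%:S * 't ^+ 2 / B) = 2 * rho%:P%:S * 't ^+ 2 / B'.
  rewrite fps_lift_div // lB (fps_liftM (2 * rho%:S)) (fps_liftM 2) fps_lift_nat.
  by rewrite fps_liftC fps_liftX fps_lift_var.
have iB0 : B^-1 0%N = 4^-1.
  have := congr1 (fun f : fps C => f 0%N) (divrr uB).
  rewrite fps_coefM0 four_sub_t2_0 fps_coef1.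
  by move=> e; apply: (mulrI (unitC 3)); rewrite [LHS]e divff ?pnatr_eq0.
apply: (is_genfunI _ _ _ _ _ _ lA lQ erefl).
- exact: gegenbauer_monic.
- exact: alpha_U3_0.
- exact: an.
- exact: FE.
- rewrite fps_coefM0 iB0 -(fps_const_nat _ 4) fps_coefC divff ?pnatr_eq0 //.
- by rewrite fps_coefM0 (fps_coefM0 (2 * rho%:S)) fps_coefXn mulr0 mul0r.
rewrite FE; set H := _ - _.
have HB : H * B' = 4 * 'X%:S * 't - 2 * rho%:P%:S * 't ^+ 2.
  rewrite /H mulrBl divrK // mulrA -[_ / B' * B']mulrA mulVr // mulr1.
  by ring.
have H0 : H 0%N = 0.
  rewrite fps_coefB fps_coefM0 (fps_coefM0 'X%:S) fps_coefM0.
  by rewrite (fps_coefM0 (2 * rho%:P%:S)) fps_coefXn !(mulr0, mul0r) subr0.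
have := congr1 (fun f => fps_comp (fps_lift f) H) DF.
rewrite /D /N fps_liftM !fps_liftD fps_liftN fps_lift1 fps_liftX !fps_liftM.
rewrite !fps_liftC fps_lift_var mulrDl mulrBl mul1r -mulrA expr2 -mulrA.
rewrite !fps_compD fps_compN !fps_compCM !fps_compXM // fps_comp_one fps_comp_var //;
 move: (fps_comp _ H) => G GE.
apply: (mulrI product_kernel_unit); rewrite [RHS]sum_chebyshevU3.
have u4 : 4 \is a @GRing.unit (fps {poly C}) by exact: (fps_unitS unitP 3).
apply: (mulrI u4).
have k4 : 4 * product_kernel = B' ^+ 2 - 2 * rho%:P%:S * B' * (H * B') + (H * B') ^+ 2.
  rewrite HB /B' /product_kernel; have e : 4 * 4^-1 - 1 = 0 :> fps {poly C}.
    by rewrite divrr // subrr.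
  rewrite fps_constB fps_constD (fps_constM _ ('X ^+ 2)) (fps_constM _ (rho%:P ^+ 2)).
  rewrite !fps_constX (fps_const_nat _ 4) (fps_const_nat _ 2).
  apply/eqP; rewrite -subr_eq0; apply/eqP.
  by transitivity ('t ^+ 4 * (4 * 4^-1 - 1) : fps {poly C}); [ring | rewrite e mulr0].
transitivity (4 * (B' / B') * B' *
  (G - (2 * rho)%:P%:S * (H * G) + H * (H * G))).
  by rewrite [LHS]mulrA k4 (polyCM 2) (polyC_natr _ 2) fps_constM fps_const_nat; ring.
rewrite GE divrr // mulr1.
transitivity (4 * (B' + (alpha1 - 2 * rho)%:P%:S * (H * B'))); first by ring.
by rewrite HB /B'; ring.
Qed.

End Rational.
End Chebyshev.

(** * Normalization *)

Section Dilation.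
Variable K : comNzRingType.
Implicit Types (f g F H : fps K) (c : K).

Lemma fps_dilateM c f g : fps_dilate c (f * g) = fps_dilate c f * fps_dilate c g.
Proof.
apply: fps_ext => n; rewrite fps_coefM -[LHS]/(c ^+ n * (f * g) n) fps_coefM.
rewrite mulr_sumr; apply: eq_bigr => i _ /=.
have /subnKC {1}<- : (i <= n)%N by rewrite -ltnS.
by rewrite exprD mulrACA.
Qed.

Lemma fps_dilateB c f g : fps_dilate c (f - g) = fps_dilate c f - fps_dilate c g.
Proof. by apply: fps_ext => n; rewrite /= mulrBr. Qed.

Lemma fps_dilateC c x : fps_dilate c x%:S = x%:S.
Proof. by apply: fps_ext => -[|n]; rewrite /= ?mul1r ?mulr0. Qed.

Lemma fps_dilate1 c : fps_dilate c 1 = 1.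
Proof. by rewrite -fps_const1 fps_dilateC. Qed.

Lemma fps_dilate_var c : fps_dilate c 't = c%:S * 't.
Proof.
by apply: fps_ext => -[|[|n]]; rewrite fps_coefCM /= ?mulr0 ?expr1.
Qed.

Lemma fps_dilateX c f n : fps_dilate c (f ^+ n) = fps_dilate c f ^+ n.
Proof.
by elim: n => [|n IH]; rewrite ?expr0 ?fps_dilate1 // !exprS fps_dilateM IH.
Qed.

Lemma fps_dilate_comp c F H : fps_dilate c (fps_comp F H) = fps_comp F (fps_dilate c H).
Proof.
apply: fps_ext => n; rewrite fps_coef_compE.
rewrite -[LHS]/(c ^+ n * fps_comp F H n) fps_coef_compE mulr_sumr.
by apply: eq_bigr => k _; rewrite mulrCA -fps_dilateX.
Qed.

Lemma fps_comp_dilate c F H : fps_comp (fps_dilate c F) H = fps_comp F (c%:S * H).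
Proof.
apply: fps_ext => n; rewrite !fps_coef_compE; apply: eq_bigr => k _.
rewrite exprMn -fps_constX fps_coefCM -[fps_dilate c F k]/(c ^+ k * F k).
by rewrite mulrA [F k * _]mulrC.
Qed.

Lemma fps_dilate_dilate c b f :
  fps_dilate c (fps_dilate b f) = fps_dilate (c * b) f.
Proof. by apply: fps_ext => n; rewrite /= exprMn mulrA. Qed.

Lemma fps_dilate_id f : fps_dilate 1 f = f.
Proof. by apply: fps_ext => n; rewrite /= expr1n mul1r. Qed.
End Dilation.

Section Normalization.
Variable R : realType.
Local Notation C := R[i].
Implicit Types (P : nat -> {poly C}) (d : genfun R).

Lemma fps_lift_dilate (c : C) f : fps_lift (fps_dilate c f) = fps_dilate c%:P (fps_lift f).
Proof. by apply: fps_ext => n; rewrite /= polyCM polyC_exp. Qed.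

Lemma genfun_rescale P d (c : C) :
  c != 0 -> is_genfun P d -> is_genfun P (gf_rescale c d).
Proof.
move=> c0 [mP [a0 an] FE [A0 R0] GE]; split=> //.
- by split=> [|n]; rewrite /= ?a0 ?mulr1 // mulf_neq0 ?expf_neq0.
- by rewrite /= FE; apply: fps_ext.
- by rewrite [gf_R _]/= fps_coefCM /= A0 R0 !mulr1 !mulr0.
have -> : weighted_series (gf_alpha (gf_rescale c d)) P
    = fps_dilate c%:P (weighted_series (gf_alpha d) P).
  by apply: fps_ext => n; rewrite /= -scalerA -mul_polyC polyC_exp.
rewrite -GE fps_dilateM fps_dilate_comp fps_dilateB !fps_dilateM fps_dilateC.
rewrite fps_dilate_var -!fps_lift_dilate.
rewrite [gf_A (gf_rescale _ _)]/= [gf_F (gf_rescale _ _)]/= [gf_R (gf_rescale _ _)]/=.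
rewrite fps_liftM fps_liftC [fps_lift (fps_dilate c (gf_F d))]fps_lift_dilate.
rewrite fps_comp_dilate; congr (_ * fps_comp _ _).
have cc : c%:P%:S * c^-1%:P%:S = 1 :> fps {poly C}.
  by rewrite -fps_constM -polyCM divff // fps_const1.
move: cc; move: c%:P%:S c^-1%:P%:S (fps_lift _) (fps_lift _) => x y g f xy.
transitivity ('X%:S * 't * x * f - x * y * g); first by ring.
by rewrite xy; ring.
Qed.

Lemma genfun_affine P d (kappa : C) : kappa != 0 -> gf_A d = 1 ->
  is_genfun P d -> is_genfun P (gf_affine kappa d).
Proof.
move=> k0 A1 [mP [a0 an] FE [A0 R0] GE].
have FkE n : (1 + kappa%:S * (gf_F d - 1)) n = gf_alpha (gf_affine kappa d) n.
  rewrite fps_coefD fps_coefCM fps_coefB !fps_coef1 FE; case: n => [|n] /=.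
    by rewrite a0 subrr mulr0 addr0.
  by rewrite subr0 add0r.
split=> //.
- by split=> // -[|n] /=; [exact: an | rewrite mulf_neq0].
- exact: fps_ext.
rewrite [gf_A _]/= [gf_R _]/= [gf_F _]/= A1 fps_lift1 mul1r mulr1.
move: GE; rewrite A1 fps_lift1 mul1r mulr1 => GE.
rewrite fps_liftD fps_liftM fps_liftB fps_lift1 fps_liftC.
rewrite fps_compD fps_compCM fps_compB fps_comp_one GE.
apply: fps_ext => n; rewrite fps_coefD fps_coefCM fps_coefB !fps_coef1.
case: n => [|n] /=; last by rewrite add0r subr0 mul_polyC scalerA.
have [/monicP lc sz] := mP 0%N.
have P0 : P 0%N = 1.
  have /size1_polyC PE : (size (P 0%N) <= 1)%N by rewrite sz.
  by move: lc; rewrite PE lead_coefC => ->.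
by rewrite a0 scale1r P0 subrr mulr0 addr0.
Qed.
End Normalization.

(** * Recurrences for the weights of a Gegenbauer generating function *)

Section Converse.
(* Keeps [/=] from unfolding the two series while it computes indices. *)
Local Opaque log_deriv_A deriv_R_over_A.

Variable R : realType.
Local Notation C := R[i].
Variables (lambda : C) (d : genfun R).
Hypothesis lambda_neq : forall m, lambda + m.+1%:R != 0.
Hypothesis gd : is_genfun (gegenbauer lambda) d.
Local Notation P := (gegenbauer lambda).
Local Notation a := (gf_alpha d).
Local Notation L := (log_deriv_A d).
Local Notation Q := (deriv_R_over_A d).

Let a0 : a 0 = 1. Proof. by have [_ []] := gd. Qed.
Let a_neq0 n : a n != 0. Proof. by have [_ []] := gd. Qed.

Let coef1 m : gf_coef P d m.+1 m = 0.
Proof. by rewrite /gf_coef gegenbauer_coef1 mulr0. Qed.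

Let coef3 m : gf_coef P d m.+3 m = 0.
Proof. by rewrite /gf_coef gegenbauer_coef3 mulr0. Qed.

Let coef2 m : gf_coef P d m.+2 m
  = - (a m.+2 * ((m%:R + 2) * (m%:R + 1) / (4 * (m%:R + 1 + lambda)))).
Proof. by rewrite /gf_coef gegenbauer_coef2 // mulrN. Qed.

(** Step 1.  The terms in L_0 and Q_0 drop out whatever these are, because they
    multiply coefficients of the wrong parity. *)
Lemma genfun_gegenbauer_rec1 j :
  (j%:R + 2) * a j.+2 = 2 * (j%:R + 1 + lambda) * (Q 1%N * a j.+1 - L 1%N * a j).
Proof.
have := genfun_coef_add 1 j gd; rewrite !big_ord_recr big_ord0 /=.
rewrite subn0 subnn addn1 addn0 !coef1 !(gf_coef_diag _ gd) coef2 !mulr0 subrr !add0r.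
have l1 := lambda_neq1 lambda_neq j; have j1 : j%:R + 1 != 0 :> C.
  by rewrite natr1 pnatr_eq0.
rewrite -(natr1 j) => e; apply: (mulfI j1).
transitivity (- (2 * (j%:R + 1 + lambda)) * (2 * - (a j.+2 * ((j%:R + 2) * (j%:R + 1) / (4 * (j%:R + 1 + lambda)))))).
  by field; nonzero.
by rewrite e; ring.
Qed.

Hypothesis nongeometric : ~ geometric a.

(** The hypothesis holds at step i for i = 0 and, once that is settled, for i = 2,
    since C_n has the parity of n. *)
Let even_zero i : (forall j, i.+1%:R * gf_coef P d (j + i).+1 j
  - j.+1%:R * \sum_(k < i) (L k * gf_coef P d (j + (i - k)) j
       - Q k * gf_coef P d (j + (i - k)).+1 j.+1) = 0) -> L i = 0 /\ Q i = 0.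
Proof.
move=> h; apply: (proportional_shift a0 _ nongeometric) => j.
have := genfun_coef_addS i j gd; rewrite h => /eqP.
by rewrite mulf_eq0 pnatr_eq0 /= subr_eq0 => /eqP.
Qed.

Let LQ0 : L 0%N = 0 /\ Q 0%N = 0.
Proof. by apply: even_zero => j; rewrite big_ord0 addn0 coef1 !mulr0 subr0. Qed.

Let LQ2 : L 2%N = 0 /\ Q 2%N = 0.
Proof.
apply: even_zero => j; rewrite !big_ord_recr big_ord0 /= subn0 !addn2.
have [-> ->] := LQ0; rewrite -[(2 - 1)%N]/1%N !addn1 !coef1 coef3.
by rewrite !mul0r !mulr0 subr0 !addr0 mulr0 subr0.
Qed.

(** Step 3.  Step 1 at j + 2 eliminates alpha_(j+4); alpha_(j+3) then cancels, and
    the remaining factor of alpha_(j+2) is the difference of two consecutive second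
    coefficients, that is omega_(j+2). *)
Lemma genfun_gegenbauer_rec3 j :
  L 1%N * gegenbauer_omega lambda j.+2 * a j.+2 = Q 3%N * a j.+1 - L 3%N * a j.
Proof.
have := genfun_coef_add 3 j gd; rewrite !big_ord_recr big_ord0 /= subn0 subnn.
have [-> ->] := LQ0; have [-> ->] := LQ2; rewrite -[(3 - 1)%N]/2%N !addn2 addn3 addn0.
rewrite !(gf_coef_diag _ gd) !mul0r subrr !addr0 add0r.
rewrite coef2 /gf_coef gegenbauer_coef4 // gegenbauer_coef2 //.
have rec := genfun_gegenbauer_rec1 j.+2.
have om : gegenbauer_omega lambda j.+2 = (P j.+2)`_j - (P j.+3)`_j.+1.
  by rewrite (gegenbauer_coefSS _ j.+1) gegenbauer_coef_diag mulr1 opprB addrC subrK.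
rewrite om !gegenbauer_coef2 //.
have l1 := lambda_neq1 lambda_neq j; have l2 := lambda_neq2 lambda_neq j.
have l3 := lambda_neq3 lambda_neq j.
have j1 : j%:R + 1 != 0 :> C by rewrite natr1 pnatr_eq0.
rewrite -(natr1 j.+1) -(natr1 j) in rec *.
have rec' : (j%:R + 4) * a j.+4 =
  2 * (j%:R + 3 + lambda) * (Q 1%N * a j.+3 - L 1%N * a j.+2).
  by rewrite (_ : j%:R + 4 = j%:R + 1 + 1 + 2); [rewrite rec; ring | ring].
set p2 := _ / (4 * (j%:R + 1 + lambda)).
have e1 : j%:R + 1 + 2 = j%:R + 3 :> C by ring.
have e2 : j%:R + 1 + 1 = j%:R + 2 :> C by ring.
rewrite e1 e2; set p2' := _ / (4 * (j%:R + 2 + lambda)) => e.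
have {e} e : p2' * (Q 1%N * a j.+3 - L 1%N * a j.+2) =
   - L 1%N * (a j.+2 * p2) + Q 1%N * (a j.+3 * p2') + (L 3%N * a j - Q 3%N * a j.+1).
  apply: (mulfI j1).
  transitivity (4 * (a j.+4 * ((j%:R + 4) * (j%:R + 3) * (j%:R + 2) * (j%:R + 1) /
    (32 * (j%:R + 3 + lambda) * (j%:R + 2 + lambda))))); last by rewrite e; ring.
  transitivity ((j%:R + 1) * p2' / (2 * (j%:R + 3 + lambda)) * ((j%:R + 4) * a j.+4)).
    by rewrite rec'; field; nonzero.
  by rewrite /p2'; field; nonzero.
apply/eqP; rewrite -subr_eq0; apply/eqP.
transitivity (- L 1%N * (a j.+2 * p2) + Q 1%N * (a j.+3 * p2') + (L 3%N * a j - Q 3%N * a j.+1)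
  - p2' * (Q 1%N * a j.+3 - L 1%N * a j.+2)); first by ring.
by rewrite e subrr.
Qed.

End Converse.

(** * Classification *)

Section Classification.
Variable R : realType.
Local Notation C := R[i].
Variables (lambda : C) (d : genfun R).
Hypothesis lambda_neq : forall m, lambda + m.+1%:R != 0.
Hypothesis gd : is_genfun (gegenbauer lambda) d.
Local Notation P := (gegenbauer lambda).
Local Notation a := (gf_alpha d).
Local Notation L := (log_deriv_A d).
Local Notation Q := (deriv_R_over_A d).
Local Notation rec1 := (genfun_gegenbauer_rec1 lambda_neq gd).

Let a0 : a 0 = 1. Proof. by have [_ []] := gd. Qed.
Let a_neq0 n : a n != 0. Proof. by have [_ []] := gd. Qed.
Let nS_neq0 n : n%:R + 1 != 0 :> C. Proof. by rewrite natr1 pnatr_eq0. Qed.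

(** For geometric weights step 1 says that (j + 2) / (j + 1 + lambda) does not
    depend on j; compare j = 0 and j = 1. *)
Lemma geometric_lambda1 : geometric a -> lambda = 1.
Proof.
move=> geo; set x := a 1%N; have x0 : x != 0 by exact: a_neq0.
have r0 := rec1 0%N; have r1 := rec1 1%N.
rewrite (geo 2%N) a0 -/x in r0; rewrite (geo 3%N) (geo 2%N) -/x in r1.
set K := Q 1%N * x - L 1%N.
have e0 : x ^+ 2 = (1 + lambda) * K.
  have n2 : 2 != 0 :> C by rewrite pnatr_eq0.
  apply: (mulfI n2); transitivity ((0 + 2) * x ^+ 2); first by ring.
  by rewrite r0 /K; ring.
have e1 : 3 * x ^+ 2 = 2 * (2 + lambda) * K.
  apply: (mulfI x0); transitivity ((1 + 2) * x ^+ 3); first by ring.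
  by rewrite r1 /K; ring.
have K0 : K != 0.
  apply: contra_neq x0 => K0; move/eqP: e0.
  by rewrite K0 mulr0 expf_eq0 => /eqP.
apply/eqP; rewrite -subr_eq0; apply/eqP; apply: (mulIf K0); rewrite mul0r.
transitivity (3 * ((1 + lambda) * K) - 2 * (2 + lambda) * K); first by ring.
by rewrite -e0 e1 subrr.
Qed.

(** Weights that agree after normalization suffice, by [genfun_uniq]. *)
Lemma genfun_rescale_uniq (c : C) d0 : c != 0 -> is_genfun P d0 ->
  (forall n, c ^+ n * gf_alpha d0 n = a n) -> ~ geometric a -> normalization d0 d.
Proof.
move=> c0 gd0 aE ng; suff -> : d = gf_rescale c d0 by exact: norm_rescale.
apply: (genfun_uniq gd (genfun_rescale c0 gd0)); last by left.
by apply/boolp.funext => n; rewrite /= aE.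
Qed.

Lemma genfun_affine_uniq (c kappa : C) d0 : c != 0 -> kappa != 0 -> gf_A d0 = 1 ->
  is_genfun P d0 -> (forall n, kappa * (c ^+ n.+1 * gf_alpha d0 n.+1) = a n.+1) ->
  ~ geometric a -> normalization d0 d.
Proof.
move=> c0 k0 A1 gd0 aE ng; have gd1 := genfun_rescale c0 gd0.
have A1' : gf_A (gf_rescale c d0) = 1 by rewrite /= A1 fps_dilate1.
suff -> : d = gf_affine kappa (gf_rescale c d0).
  by apply: norm_trans (norm_rescale _ c0) (norm_affine k0 A1').
apply: (genfun_uniq gd (genfun_affine k0 A1' gd1)); last by left.
apply/boolp.funext => -[|n]; rewrite /= ?aE //.
by rewrite a0 mul1r; have [_ [-> _]] := gd0.
Qed.

(** The weights leave A free here, so A is read off from d, up to rescaling. *)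
Lemma geometric_listed : geometric a ->
  exists2 d0, listed lambda d0 & normalization d0 d.
Proof.
move=> geo; have l1 := geometric_lambda1 geo; set x := a 1%N.
have x0 : x != 0 by exact: a_neq0.
have [_ _ _ [A0 _] _] := gd; set A := fps_dilate x^-1 (gf_A d).
have A1 : A 0%N = 1 by rewrite /= A0 mulr1.
exists (gf_U1 A); first exact: listed_U1.
suff -> : d = gf_rescale x (gf_U1 A) by exact: norm_rescale.
have gU : is_genfun P (gf_U1 A) by rewrite l1; exact: genfun_U1.
apply: (genfun_uniq gd (genfun_rescale x0 gU)).
  by apply/boolp.funext => n; rewrite geo /= mulr1.
by right; rewrite /= fps_dilate_dilate divff // fps_dilate_id.
Qed.

Hypothesis nongeometric : ~ geometric a.

Lemma listed_L1_eq0 : L 1%N = 0 -> exists2 d0, listed lambda d0 & normalization d0 d.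
Proof.
move=> L1; have rec j : (j%:R + 2) * a j.+2 = 2 * Q 1%N * (j%:R + 1 + lambda) * a j.+1.
  by rewrite rec1 L1 mul0r subr0; ring.
set c := 2 * Q 1%N in rec.
have c0 : c != 0.
  apply/eqP => c0; have := rec 0%N; rewrite c0 !mul0r add0r => /eqP.
  by rewrite mulf_eq0 pnatr_eq0 /= (negPf (a_neq0 _)).
have [l0|l0] := eqVneq lambda 0; last first.
  exists (gf_C1 lambda); first exact: listed_C1.
  have k0 : a 1%N / (c * lambda) != 0 by rewrite mulf_neq0 ?a_neq0 // invr_neq0 // (mulf_neq0 c0).
  apply: (genfun_affine_uniq c0 k0) => //; first exact: genfun_C1.
  elim=> [|n IH].
    rewrite /= /pochhammer big_ord_recl big_ord0 factS fact0 mulr0n.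
    by field; rewrite l0 c0.
  have n2 : n%:R + 2 != 0 :> C by rewrite -natrD addn2 pnatr_eq0.
  apply: (mulfI n2); rewrite rec -IH.
  have := gegenbauer_weightS lambda n.+1; rewrite -[n.+2%:R]natr1 -(natr1 n).
  rewrite -[gf_alpha (gf_C1 _) n.+2]/(gegenbauer_weight lambda n.+2).
  rewrite -[gf_alpha (gf_C1 _) n.+1]/(gegenbauer_weight lambda n.+1).
  move: (gegenbauer_weight lambda n.+2) (gegenbauer_weight lambda n.+1) => w2 w1 e.
  transitivity (a 1%N / (c * lambda) * c ^+ n.+2 * ((n%:R + 1 + 1) * w2)); first by ring.
  by rewrite e (exprS c n.+1); ring.
exists (gf_T R); first exact: listed_T.
have k0 : a 1%N / c != 0 by rewrite mulf_neq0 ?a_neq0 ?invr_neq0.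
apply: (genfun_affine_uniq c0 k0) => //; first by rewrite l0; exact: genfun_T.
elim=> [|n IH]; first by rewrite /= expr1; field.
have n2 : n%:R + 2 != 0 :> C by rewrite -natrD addn2 pnatr_eq0.
apply: (mulfI n2); rewrite rec -IH l0 /= -(natr1 n.+1) -(natr1 n) (exprS c n.+1).
rewrite (_ : n%:R + 1 + 1 = n%:R + 2 :> C); last by ring.
by field; rewrite nS_neq0 n2 c0.
Qed.

(** Step 1 is alpha_(j+2) = 2 Q_1 alpha_(j+1) - 2 L_1 alpha_j; rescaling by a square
    root of 2 L_1 makes the last coefficient 1, as in the recurrence of the
    weights [alpha_U3]. *)
Lemma listed_lambda1 : L 1%N != 0 -> lambda = 1 ->
  exists2 d0, listed lambda d0 & normalization d0 d.
Proof.
move=> L1 l1; set c := sqrtC (2 * L 1%N).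
have c2 : c ^+ 2 = 2 * L 1%N by rewrite sqrtCK.
have c0 : c != 0 by rewrite sqrtC_eq0 mulf_neq0 ?pnatr_eq0.
set rho := Q 1%N / c; set alpha1 := a 1%N / c.
have aE n : c ^+ n * alpha_U3 rho alpha1 n = a n.
  suff [] : c ^+ n * alpha_U3 rho alpha1 n = a n
         /\ c ^+ n.+1 * alpha_U3 rho alpha1 n.+1 = a n.+1 by [].
  elim: n => [|n [IH1 IH2]].
    rewrite expr0 expr1 a0 alpha_U3_0 alpha_U3_1 mulr1; split=> //.
    by rewrite /alpha1 mulrC divfK.
  split=> //; have n2 : n%:R + 2 != 0 :> C by rewrite -natrD addn2 pnatr_eq0.
  apply: (mulfI n2); rewrite rec1 l1 alpha_U3_SS -IH1 -IH2.
  transitivity ((n%:R + 2) * (2 * (c * rho) * (c ^+ n.+1 * alpha_U3 rho alpha1 n.+1)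
     - c ^+ 2 * (c ^+ n * alpha_U3 rho alpha1 n))).
    by rewrite !exprS expr0; ring.
  by rewrite c2 /rho [c * (_ / _)]mulrC divfK //; ring.
have aU0 n : alpha_U3 rho alpha1 n != 0.
  by apply: contraNneq (a_neq0 n) => z; rewrite -aE z mulr0.
exists (gf_U3 rho alpha1); first exact: listed_U3.
apply: (genfun_rescale_uniq c0) => //; rewrite l1.
exact: genfun_U3.
Qed.

Lemma listed_lambda_neq1 : L 1%N != 0 -> lambda != 1 ->
  exists2 d0, listed lambda d0 & normalization d0 d.
Proof.
move=> L1 l1; have rec3 := genfun_gegenbauer_rec3 lambda_neq gd nongeometric.
have ng : ~ (exists x, forall n, a n.+1 = x * a n).
  by case=> x ax; apply: nongeometric; apply: geometricP ax.
have [l0 [c c0 aS]] := alpha_ratio lambda_neq a_neq0 rec1 rec3 L1 l1 ng.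
exists (gf_C2 lambda); first exact: listed_C2.
apply: (genfun_rescale_uniq c0) => //; first exact: genfun_C2.
elim=> [|n IH]; first by rewrite /= /pochhammer big_ord0 fact0 divr1 mulr1 a0.
apply: (mulfI (nS_neq0 n)); rewrite aS -IH.
have := gegenbauer_weightS (lambda + 1) n; rewrite -(natr1 n).
rewrite -[gf_alpha (gf_C2 _) n.+1]/(gegenbauer_weight (lambda + 1) n.+1).
rewrite -[gf_alpha (gf_C2 _) n]/(gegenbauer_weight (lambda + 1) n).
move: (gegenbauer_weight _ n.+1) (gegenbauer_weight _ n) => w2 w1 e.
transitivity (c ^+ n.+1 * ((n%:R + 1) * w2)); first by ring.
by rewrite e (exprS c n); ring.
Qed.
End Classification.

Lemma genfun_gegenbauer_listed (R : realType) (lambda : R[i]) (d : genfun R) :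
  (forall m, lambda + m.+1%:R != 0) -> is_genfun (gegenbauer lambda) d ->
  exists2 d0 : genfun R, listed lambda d0 & normalization d0 d.
Proof.
move=> ln gd; have [geo|ng] := boolp.EM (geometric (gf_alpha d)).
  exact: geometric_listed geo.
have [L1|L1] := eqVneq (log_deriv_A d 1%N) 0; first exact: listed_L1_eq0.
have [l1|l1] := eqVneq lambda 1; first exact: listed_lambda1.
exact: listed_lambda_neq1.
Qed.

Theorem theorem3p1 (R : realType) (lambda : R) (hlambda : - 2^-1 <= lambda) :
  (lambda != 0 ->
    is_genfun (gegenbauer lambda%:C) (gf_C1 lambda%:C) /\
    weighted_series (fun n => pochhammer lambda%:C n / n`!%:R)
                    (gegenbauer lambda%:C)
    = fps_power (1 - 't * 'X%:S + 't ^+ 2 / 4) (- lambda%:C)%:P) /\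
  (lambda != 0 ->
    is_genfun (gegenbauer lambda%:C) (gf_C2 lambda%:C) /\
    weighted_series (fun n => pochhammer (lambda%:C + 1) n / n`!%:R)
                    (gegenbauer lambda%:C)
    = (1 - 't ^+ 2 / 4)
      * fps_power (1 - 't * 'X%:S + 't ^+ 2 / 4) (- lambda%:C - 1)%:P) /\
  (is_genfun (@chebyshevT R) (gf_T R) /\
    weighted_series (fun n => if n is 0%N then 0 else n%:R^-1) (@chebyshevT R)
    = - fps_ln (1 - 'X%:S * 't + 't ^+ 2 / 4)) /\
  ((forall A : fps R[i], A 0%N = 1 -> is_genfun (@chebyshevU R) (gf_U1 A)) /\
    weighted_series (fun=> 1) (@chebyshevU R)
    = 1 / (1 - 'X%:S * 't + 't ^+ 2 / 4)) /\
  (forall rho alpha1 : R[i], rho != 0 -> alpha1 != 0 ->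
    is_genfun (@chebyshevU R) (gf_U2 rho alpha1) /\
    1 + alpha1%:P%:S
        * weighted_series
            (fun n => if n is m.+1 then 2 ^+ m * rho ^+ m else 0)
            (@chebyshevU R)
    = (1 + (alpha1 - 2 * rho)%:P%:S
           * ('X%:S * 't - (rho / 2)%:P%:S * 't ^+ 2))
      / (1 - 2 * rho%:P%:S * 'X%:S * 't + (rho ^+ 2)%:P%:S * 't ^+ 2)) /\
  (forall rho alpha1 : R[i], (forall n, alpha_U3 rho alpha1 n != 0) ->
    is_genfun (@chebyshevU R) (gf_U3 rho alpha1) /\
    weighted_series (alpha_U3 rho alpha1) (@chebyshevU R)
    = (4 - 't ^+ 2 + 2 * (alpha1 - 2 * rho)%:P%:S
                     * (2 * 'X%:S * 't - rho%:P%:S * 't ^+ 2))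
      / (4 - 8 * rho%:P%:S * 'X%:S * 't
         + (4 * rho%:P ^+ 2 + 4 * 'X ^+ 2 - 2)%:S * 't ^+ 2
         - 2 * rho%:P%:S * 'X%:S * 't ^+ 3 + 't ^+ 4 / 4)) /\
  (forall d : genfun R, is_genfun (gegenbauer lambda%:C) d ->
    exists2 d0 : genfun R, listed lambda%:C d0 & normalization d0 d).
Proof.
have ln m : lambda%:C + m.+1%:R != 0 :> R[i].
  rewrite -(rmorph_nat (real_complex R)) -rmorphD fmorph_eq0 lt0r_neq0 //.
  by have : 0 <= m%:R :> R := ler0n _ _; rewrite -natr1; lra.
have lC : lambda != 0 -> lambda%:C != 0 :> R[i] by rewrite fmorph_eq0.
have kE : 1 - 't * 'X%:S + 't ^+ 2 / 4 = @gegenbauer_kernel R.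
  by rewrite /gegenbauer_kernel ['t * _]mulrC.
split; last split; last split; last split; last split; last split.
- move=> /lC l0; rewrite kE; split; first exact: genfun_C1.
  exact: sum_weighted_gegenbauer.
- move=> /lC l0; rewrite kE; split; first exact: genfun_C2.
  exact: sum_weighted_gegenbauer2.
- by split; [exact: genfun_T | exact: sum_chebyshevT].
- split; first exact: genfun_U1.
  apply: (mulrI (gegenbauer_kernel_unit R)).
  by rewrite sum_chebyshevU mul1r divrr ?gegenbauer_kernel_unit.
- move=> rho alpha1 r0 a0; split; first exact: genfun_U2.
  apply: (mulrI (chebyshevU_kernel_unit rho)).
  by rewrite sum_chebyshevU2 [RHS]mulrC divrK ?chebyshevU_kernel_unit.
- move=> rho alpha1 an; split; first exact: genfun_U3.
  apply: (mulrI (product_kernel_unit rho)).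
  by rewrite sum_chebyshevU3 [RHS]mulrC divrK ?product_kernel_unit.
- by move=> d gd; exact: genfun_gegenbauer_listed.
Qed.
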